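(* Let $|q|<1$ and $(a,b)$ a pair of coprime integers with $1\leq b<a$. If $a\le 2b$ then \[ \sum_{m\in\mathbb Z_{\ge0}^{d}}\frac{q^{m^TCm}}{(q)_{\tau_1m_1}}\prod_{j=2}^{d}\begin{bmatrix}\tau_jm_j+n_j\\ \tau_jm_j\end{bmatrix} =\frac{(q^{ab},q^{ab+1},q^{2ab+1};q^{2ab+1})_\infty}{(q;q)_\infty}, \] and if $a>2b$ then \[ \sum_{\substack{n_1,\dots,n_{a_0}\ge0\\ m_{a_0+1},\dots,m_d\ge0}}\frac{q^{\sum_{i=1}^{a_0}(N_i+m_{a_0+1})^2+\sum_{j,k=a_0+1}^{d}m_jC_{j,k}m_k}}{(q)_{n_1}\cdots(q)_{n_{a_0}}(q)_{\tau_{a_0+1}m_{a_0+1}}}\prod_{j=a_0+2}^d\begin{bmatrix}\tau_jm_j+n_j\\ \tau_jm_j\end{bmatrix} =\frac{(q^{ab},q^{ab+1},q^{2ab+1};q^{2ab+1})_\infty}{(q;q)_\infty}. \]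
   Context: Notation: $(x;q)_n=\prod_{i=0}^{n-1}(1-xq^i)$ (also for $n=\infty$), $(q)_n=(q;q)_n$, $(x_1,\dots,x_r;q)_\infty=\prod_i(x_i;q)_\infty$; $\begin{bmatrix}n\\ m\end{bmatrix}=\frac{(q)_n}{(q)_m(q)_{n-m}}$ if $m,n-m$ are nonnegative integers, $0$ otherwise. Continued-fraction data: for coprime $1\le b<a$ let $\mathrm{cf}(a,b)=(a/b-1)^{s}$ with $s=1$ if $a>2b$, $s=-1$ if $a<2b$, $s=0$ if $a=2b$. Write $\mathrm{cf}(a,b)=[a_0,\dots,a_n]$ (regular continued fraction with positive integer partial quotients), choosing $a_n\ge 2$ when $(a,b)\ne(2,1)$ (and $\mathrm{cf}(2,1)=[1]$). Put $t_0=0$, $t_j=a_0+\dots+a_{j-1}$ ($1\le j\le n+1$), $d=t_{n+1}$. $\mathcal I$ is the $d\times d$ matrix with $\mathcal I_{j,k}=\delta_{j,k+1}+\delta_{j,k-1}$ if $j\notin\{t_1,\dots,t_{n+1}\}$ and $\delta_{j,k+1}+\delta_{j,k}-\delta_{j,k-1}$ otherwise; $C=2I-\mathcal I$. $\tau_j=2$ for $j<d$, $\tau_d=1$. $m^TCm=\sum_{j,k}m_jC_{j,k}m_k$. In the case $a\le 2b$, $n_j=-\sum_{k=1}^dC_{j,k}m_k$ for $j\ge 2$. In the case $a>2b$: $N_i=n_i+\dots+n_{a_0}$; $n_j=-\sum_{k=a_0+1}^dC_{j,k}m_k$ for $j\ge a_0+2$; if $d=a_0$ (exactly when $b=1$)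 there are no variables $m_{a_0+1},\dots,m_d$, one sets $m_{a_0+1}=0$, and the sum over $j,k\ge a_0+1$ and the final product are empty. *)

(* Defs.v *)
From HB Require Import structures.
From mathcomp Require Import all_boot all_order all_algebra.
From mathcomp Require Import complex.
From mathcomp Require Import all_classical all_reals topology normedtype sequences.
Import Order.TTheory GRing.Theory Num.Theory.
Import numFieldNormedType.Exports.
Set Implicit Arguments.
Unset Strict Implicit.
Unset Printing Implicit Defensive.
Local Open Scope classical_set_scope.
Local Open Scope ring_scope.

Definition cvgC {R : realType} (u : nat -> R[i]) (L : R[i]) : Prop :=
  ((u : nat -> (R[i])^o) @ \oo --> (L : (R[i])^o)).
Definition limC {R : realType} (u : nat -> R[i]) : R[i] :=
  limn (u : nat -> (R[i])^o).

Definition qpoch {R : realType} (x q : R[i]) (n : nat) : R[i] :=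
  \prod_(i < n) (1 - x * q ^+ i).
Definition qfac {R : realType} (q : R[i]) (n : nat) : R[i] := qpoch q q n.
Definition qpoch_inf {R : realType} (x q : R[i]) : R[i] :=
  limC (fun n => qpoch x q n).
Definition qbin {R : realType} (q : R[i]) (n m : int) : R[i] :=
  if (0 <= m)%R && (0 <= n - m)%R then
    qfac q (absz n) / (qfac q (absz m) * qfac q (absz (n - m)))
  else 0.

Fixpoint cf_aux (fuel p r : nat) : seq nat :=
  match fuel with
  | 0 => [::]
  | f.+1 => if r == 0 then [::] else (p %/ r)%N :: cf_aux f r (p %% r)%N
  end.

(* the rational number (a/b-1)^s, as a pair (numerator, denominator) *)
Definition cf_frac (a b : nat) : nat * nat :=
  if (2 * b < a)%N then ((a - b)%N, b)          (* s = 1 *)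
  else if (a < 2 * b)%N then (b, (a - b)%N)     (* s = -1 *)
  else (1, 1).                          (* s = 0 : value 1 *)

Definition cf (a b : nat) : seq nat :=
  let pr := cf_frac a b in cf_aux (pr.1 + pr.2)%N pr.1 pr.2.

Definition cfa0 (a b : nat) : nat := nth 0 (cf a b) 0.
Definition cft (a b : nat) (j : nat) : nat := (\sum_(i < j) nth 0 (cf a b) i)%N.
Definition cfd (a b : nat) : nat := cft a b (size (cf a b)).
Definition is_t (a b : nat) (j : nat) : bool :=
  j \in [seq cft a b k | k <- iota 1 (size (cf a b))].

(* the matrix \mathcal I (1-based indices j, k in 1..d) *)
Definition Imat (a b : nat) (j k : nat) : int :=
  if is_t a b j then
    ((k.+1 == j)%:Z + (j == k)%:Z - (j.+1 == k)%:Z)%R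
  else ((k.+1 == j)%:Z + (j.+1 == k)%:Z)%R.
Definition Cmat (a b : nat) (j k : nat) : int :=
  (2 * (j == k)%:Z - Imat a b j k)%R.
Definition tau (a b : nat) (j : nat) : nat := if (j < cfd a b)%N then 2%N else 1%N.

Definition term_le {R : realType} (q : R[i]) (a b : nat) (m : nat -> nat) : R[i] :=
  let d := cfd a b in
  let C := Cmat a b in
  let n := fun j => (- \sum_(1 <= k < d.+1) C j k * (m k)%:Z)%R in
  let quad := (\sum_(1 <= j < d.+1) \sum_(1 <= k < d.+1)
                 (m j)%:Z * C j k * (m k)%:Z)%R in
  q ^ quad / qfac q (tau a b 1 * m 1)%N
    * \prod_(2 <= j < d.+1)
        qbin q ((tau a b j * m j)%N%:Z + n j)%R (tau a b j * m j)%N%:Z.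

(* Case a > 2b : x = (n_1, ..., n_{a_0}, m_{a_0+1}, ..., m_d) *)
Definition term_gt {R : realType} (q : R[i]) (a b : nat) (x : nat -> nat) : R[i] :=
  let d := cfd a b in
  let a0 := cfa0 a b in
  let C := Cmat a b in
  let ma := if (a0 < d)%N then x a0.+1 else 0%N in
  let NN := fun i => (\sum_(i <= l < a0.+1) x l)%N in
  let n := fun j => (- \sum_(a0.+1 <= k < d.+1) C j k * (x k)%:Z)%R in
  let expo := ((\sum_(1 <= i < a0.+1) (NN i + ma) ^ 2)%N%:Z
               + \sum_(a0.+1 <= j < d.+1) \sum_(a0.+1 <= k < d.+1)
                   (x j)%:Z * C j k * (x k)%:Z)%R in
  q ^ expo
    / ((\prod_(1 <= i < a0.+1) qfac q (x i)) * qfac q (tau a b a0.+1 * ma)%N)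
    * \prod_(a0.+2 <= j < d.+1)
        qbin q ((tau a b j * x j)%N%:Z + n j)%R (tau a b j * x j)%N%:Z.

(* ---------- summation over Z_{>=0}^d as the limit of box partial sums ---------- *)
(* extend f : 'I_d -> 'I_N to a 1-based vector nat -> nat (0 outside 1..d) *)
Definition ext_vec {d N : nat} (f : {ffun 'I_d -> 'I_N}) (j : nat) : nat :=
  if j is j'.+1 then (if insub j' is Some i then val (f i) else 0%N) else 0%N.

Definition box_sum {R : realType} (d : nat) (F : (nat -> nat) -> R[i]) (N : nat) : R[i] :=
  \sum_(f : {ffun 'I_d -> 'I_N}) F (ext_vec f).

Definition rhs {R : realType} (q : R[i]) (a b : nat) : R[i] :=
  let M := q ^+ (2 * (a * b)).+1%N in
  qpoch_inf (q ^+ (a * b)%N) M * qpoch_inf (q ^+ (a * b).+1%N) M * qpoch_inf M M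
    / qpoch_inf q q.

(* Main.v *)
(** Write [B(L,M,a,b)] for the product of q-binomials
    [[L+M+a-b; L+a] [L+M-a+b; L-a]] and put
    [F_{x,y}(L,M) = sum_j (-1)^j q^(j((2xy+1)j+1)/2) B(L,M,xj,yj)].
    The Burge transform (a finite q-Saalschuetz sum)
    [sum_i q^(i^2) [2L+M-i; 2L] B(L-i,i,a,b) = q^(b^2) B(L,M,a+b,b)]
    turns [F_{x,y}] into [F_{x+y,y}], while [F_{x,y}(L,M) = F_{y,x}(M,L)] and
    [F_{1,1}(L,M) = [L+M; L]].  Running the subtractive Euclidean algorithm
    downwards from a coprime pair therefore expands [F_{x,y}] as a manifestly
    positive multiple sum whose summation variables are the [m_j]; the indices
    [t_i] are the steps where the pair has to be swapped.  If [L = M] tends to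
    infinity, the last Burge step gives
    [sum_r q^(r^2) F_{a-b,b}(oo,r) = (q)_oo^(-1) sum_j (-1)^j q^(j((2ab+1)j+1)/2)],
    which the Jacobi triple product evaluates.  For [a <= 2b] one expands
    [F_{a-b,b}(oo,r) = F_{b,a-b}(r,oo)] directly; for [a > 2b] the first [a_0]
    steps keep the first argument infinite and produce the variables [n_i]. *)
Require Import Defs.
From HB Require Import structures.
From mathcomp Require Import all_boot all_order all_algebra.
From mathcomp Require Import complex.
From mathcomp Require Import all_classical all_reals topology normedtype sequences.
From mathcomp Require Import ring lra zify.
Import Order.TTheory GRing.Theory Num.Theory.
Import numFieldNormedType.Exports.
Local Open Scope ring_scope.

Set Implicit Arguments.
Unset Strict Implicit.
Unset Printing Implicit Defensive.

(** * q-factorials and the Burge transform *)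

Definition qprod {K : fieldType} (x q : K) (n : nat) : K :=
  \prod_(i < n) (1 - x * q ^+ i).

Notation qf q := (qprod q q).

(** [1/(q)_(n-k)], with the convention that it vanishes for [n < k]; this is
    what makes the boundary cases of the recurrences below uniform. *)
Definition inv_qfac {K : fieldType} (q : K) (n k : nat) : K :=
  if (k <= n)%N then (qf q (n - k))^-1 else 0.

Section QAlgebra.
Variables (K : fieldType) (q : K).
Hypothesis hq : forall n, 1 - q ^+ n.+1 != 0.

Lemma qf0 : qf q 0 = 1.
Proof. by rewrite /qprod big_ord0. Qed.

Lemma qfS n : qf q n.+1 = qf q n * (1 - q ^+ n.+1).
Proof. by rewrite /qprod big_ord_recr /= -exprS. Qed.

Lemma qf_neq0 n : qf q n != 0.
Proof. by elim: n => [|n IH]; rewrite ?qf0 ?oner_neq0 // qfS mulf_neq0. Qed.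

Lemma inv_qfac_small n k : (n < k)%N -> inv_qfac q n k = 0.
Proof. by rewrite /inv_qfac ltnNge => /negbTE ->. Qed.

Lemma inv_qfacDr n k : inv_qfac q (n + k) k = (qf q n)^-1.
Proof. by rewrite /inv_qfac leq_addl addnK. Qed.

Lemma inv_qfacDl n k : inv_qfac q (k + n) k = (qf q n)^-1.
Proof. by rewrite addnC inv_qfacDr. Qed.

Lemma inv_qfacn0 n : inv_qfac q n 0 = (qf q n)^-1.
Proof. by rewrite /inv_qfac subn0. Qed.

Lemma inv_qfacSS n k : inv_qfac q n.+1 k.+1 = inv_qfac q n k.
Proof. by []. Qed.

Lemma inv_qfacnS n k : inv_qfac q n k.+1 = (1 - q ^+ (n - k)) * inv_qfac q n k.
Proof.
case: (leqP k n) => [/subnKC <-|lt_nk]; last first.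
  by rewrite !inv_qfac_small ?mulr0 // ltnW.
rewrite addKn inv_qfacDl; case: (n - k)%N => [|j].
  by rewrite addn0 inv_qfac_small // subrr mul0r.
rewrite addnS inv_qfacSS inv_qfacDl qfS.
by field; rewrite hq qf_neq0.
Qed.

(** Zeilberger-style certificate for the q-Saalschuetz sum [burge_core]: the
    right-hand side is the antidifference in [k] of the recurrence in [m]. *)
Lemma burge_wz A B l m k : (k <= l)%N ->
  let T m m' k := q ^+ (k * (k + B)) * qf q (A + B + 2 * l + m - k) * inv_qfac q m' k
       / (qf q (l - k + A) * qf q (l - k) * qf q k * qf q (k + B)) in
  \sum_(i < k.+1)
     ((1 - q ^+ m.+1) * (1 - q ^+ (m.+1 + B)) * T m.+1 m.+1 i
      - (1 - q ^+ (A + B + l + m).+1) * (1 - q ^+ (l + B + m).+1) * T m m i)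
  = - q ^+ (m + k + 1 + B) * (1 - q ^+ (l - k + A)) * (1 - q ^+ (l - k))
     * T m m k.
Proof.
move=> + T; elim: k => [_|k IH ltkl].
  rewrite big_ord_recl big_ord0 addr0 /T /= !subn0 !inv_qfacn0 !mul0n qf0 add0n addn0.

  rewrite !(addSn, addnS).
  have -> : (A + B + 2 * l + m = A + B + l + l + m)%N by lia.
  rewrite ?(addn1, addSn, addnS, addn0) !qfS !exprS !exprD ?expr0.
  field.
  by rewrite !qf_neq0 -exprS hq.
rewrite big_ord_recr /= IH; last exact: ltnW.
rewrite /T.
case: (ltnP m k) => [lt_mk|/subnKC].
  by rewrite !(@inv_qfac_small m) ?(@inv_qfac_small m.+1) ?(mulr0, mul0r) ?subrr ?addr0 //; lia.
move: (m - k)%N => j <-.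
move/subnKC: ltkl; move: (l - k.+1)%N => h <-.
rewrite !inv_qfacSS inv_qfacnS inv_qfacDl !addKn.
have -> : (k.+1 + h - k = h.+1)%N by lia.
have -> : (A + B + 2 * (k.+1 + h) + (k + j) - k = (A + B + k + k + h + h + j).+2)%N by lia.
have -> : (A + B + 2 * (k.+1 + h) + (k + j) - k.+1 = (A + B + k + k + h + h + j).+1)%N by lia.
have -> : (A + B + 2 * (k.+1 + h) + (k + j).+1 - k.+1 = (A + B + k + k + h + h + j).+2)%N by lia.
rewrite !(addSn, addnS, addn1) !mulSn !mulnDr !mulnS !mulnDr !qfS !(exprS, exprD, expr0).

field.
by rewrite -!exprD -!exprS -?addSn -?addnS !hq !qf_neq0.
Qed.

(** At [k = l] the right-hand side of [burge_wz] contains the factor [1 - q^0], so the full sum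
    satisfies a first-order recurrence in [m], which the closed form satisfies too; at [m = 0] only
    the term [k = 0] survives. *)
Lemma burge_core A B l m :
  \sum_(k < l.+1) q ^+ (k * (k + B)) * qf q (A + B + 2 * l + m - k) * inv_qfac q m k
       / (qf q (l - k + A) * qf q (l - k) * qf q k * qf q (k + B))
  = qf q (A + B + 2 * l) * qf q (A + B + l + m) * qf q (l + B + m)
    / (qf q (l + A) * qf q (l + B) * qf q (A + B + l) * qf q l * qf q m * qf q (m + B)).
Proof.
elim: m => [|m IH].
  rewrite big_ord_recl big1 => [|i _]; last by rewrite inv_qfac_small // mulr0 mul0r.
  rewrite !addn0 !subn0 inv_qfacn0 mul0n !qf0 /= !add0n.
  by field; rewrite !qf_neq0 oner_neq0.
have := @burge_wz A B l m l (leqnn l); cbv zeta.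
rewrite subnn expr0 [1 - 1]subrr mulr0 mul0r big_split /= sumrN -!mulr_sumr IH => /subr0_eq.
have h1 : (1 - q ^+ m.+1) * (1 - q ^+ (m.+1 + B)) != 0 by rewrite mulf_neq0 // hq.
move/(canRL (mulKf h1)) => ->.
rewrite !(addnS, addSn) !qfS; field.
by rewrite !qf_neq0 !hq /=.
Qed.

(** This is [B(L,M,a,b)] with the denominators sorted by [L] and [M]. The numerator subtractions are
    truncated only when [b > M] or [a > L], and then an [inv_qfac] factor is zero. *)
Definition qbinom2 L M a b := qf q (L + M + a - b) * qf q (L + M + b - a)
  * (inv_qfac q L a / qf q (L + a)) * (inv_qfac q M b / qf q (M + b)).

Lemma qbinom2C L M a b : qbinom2 L M a b = qbinom2 M L b a.
Proof. by rewrite /qbinom2 (addnC L M); ring. Qed.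

Lemma qbinom2_small L M a b : (L < a)%N || (M < b)%N -> qbinom2 L M a b = 0.
Proof. by case/orP => h; rewrite /qbinom2 (inv_qfac_small h); ring. Qed.

(** A nonzero term needs [b <= i] and [a <= L - i]. Writing [L = a + b + l], [M = b + m],
    [i = b + k] leaves [burge_core] with parameters [2a] and [2b]. *)
Lemma burge L M a b :
  \sum_(i < L.+1) q ^+ (i * i) * (qf q (2 * L + M - i) / qf q (2 * L) * inv_qfac q M i)
     * qbinom2 (L - i) i a b = q ^+ (b * b) * qbinom2 L M (a + b) b.
Proof.
case: (ltnP L (a + b)) => [lt_L|/subnKC].
  rewrite (@qbinom2_small L) ?lt_L // mulr0 big1 // => i _.
  rewrite (@qbinom2_small _ _ a b) ?mulr0 //; case: i => i /=; lia.
case: (ltnP M b) => [lt_M _|/subnKC].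
  rewrite (@qbinom2_small L) ?lt_M ?orbT // mulr0 big1 // => i _.
  case: (ltnP M i) => [lt_Mi|le_iM]; first by rewrite (inv_qfac_small lt_Mi) !(mulr0, mul0r).
  by rewrite (@qbinom2_small _ _ a b) ?mulr0 //; lia.
move: (M - b)%N (L - (a + b))%N => m l <- <-.
rewrite (_ : (a + b + l).+1 = b + l.+1 + a)%N; last by lia.
rewrite 2!big_split_ord /= [X in _ + X]big1 ?addr0 => [|i _]; last first.
  by rewrite (@qbinom2_small _ _ a b) ?mulr0 //; case: i => i /=; lia.
rewrite big1 ?add0r => [|i _]; last first.
  by rewrite (@qbinom2_small _ _ a b) ?mulr0 //; case: i => i /=; lia.
transitivity (q ^+ (b * b) * (qf q (l + 2 * a) * qf q (l + 2 * b)
   / qf q (2 * (a + b + l)))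
  * \sum_(k < l.+1) q ^+ (k * (k + 2 * b))
       * qf q (2 * a + 2 * b + 2 * l + m - k) * inv_qfac q m k
       / (qf q (l - k + 2 * a) * qf q (l - k) * qf q k * qf q (k + 2 * b))).
  rewrite mulr_sumr; apply: eq_bigr => -[k /= lt_k] _.
  rewrite /qbinom2.
  have -> : (a + b + l - (b + k) + (b + k) + a - b = l + 2 * a)%N by lia.
  have -> : (a + b + l - (b + k) + (b + k) + b - a = l + 2 * b)%N by lia.
  have -> : (a + b + l - (b + k) + a = l - k + 2 * a)%N by lia.
  have -> : (b + k + b = k + 2 * b)%N by lia.
  have -> : (2 * (a + b + l) + (b + m) - (b + k) = 2 * a + 2 * b + 2 * l + m - k)%N by lia.
  have -> : (a + b + l - (b + k) = a + (l - k))%N by lia.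
  rewrite !inv_qfacDl.
  have -> : inv_qfac q (b + m) (b + k) = inv_qfac q m k by rewrite /inv_qfac leq_add2l subnDl.
  have -> : ((b + k) * (b + k) = b * b + k * (k + 2 * b))%N by lia.
  rewrite exprD; field.
  by rewrite !qf_neq0.
rewrite burge_core /qbinom2 !inv_qfacDl.
have -> : (a + b + l + (b + m) + (a + b) - b = 2 * a + 2 * b + l + m)%N by lia.
have -> : (a + b + l + (b + m) + b - (a + b) = l + 2 * b + m)%N by lia.
have -> : (a + b + l + (a + b) = 2 * a + 2 * b + l)%N by lia.
have -> : (b + m + b = m + 2 * b)%N by lia.
have -> : (2 * (a + b + l) = 2 * a + 2 * b + 2 * l)%N by lia.
by field; rewrite !qf_neq0.
Qed.

(** The terms [j] and [-j] of [(-1)^j q^(j(j-1)/2)] folded together. *)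
Definition unit_pair j : K :=
  if j is 0 then 1 else (-1) ^+ j * q ^+ 'C(j, 2) * (1 + q ^+ j).

(** As in [burge_wz], a telescoping certificate, for the recurrence in [M]. *)
Lemma seed_wz L M k :
  let U m j := unit_pair j * q ^+ (j * j) * (inv_qfac q L j / qf q (L + j))
    * (inv_qfac q m j / qf q (m + j)) in
  \sum_(j < k.+1) ((1 - q ^+ M.+1) * (1 - q ^+ (L + M).+1) * U M.+1 j - U M j)
  = (-1) ^+ k * q ^+ (M.+1 + 2 * k + 'C(k, 2) + k * k)
    * (inv_qfac q L k.+1 / qf q (L + k)) * (inv_qfac q M k / qf q (M.+1 + k)).
Proof.
move=> U; elim: k => [|k IH].
  rewrite big_ord_recl big_ord0 addr0 /U /= inv_qfacnS !inv_qfacn0 !subn0 !mul0n muln0 bin0n.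
  rewrite !(addn0, addnS, addSn) !qfS !(exprS, exprD, expr0); field.
  by rewrite !qf_neq0 -exprS hq.
rewrite big_ord_recr /= IH /U inv_qfacSS.
case: (ltnP L k.+1) => [lt_L|/subnKC].
  by rewrite !(@inv_qfac_small L) ?(mulr0, mul0r) ?subrr ?addr0 //; lia.
move: (L - k.+1)%N => l <-.
case: (ltnP M k) => [lt_M|/subnKC].
  by rewrite !(@inv_qfac_small M) ?(mulr0, mul0r) ?subrr ?addr0 //; lia.
move: (M - k)%N => m <-.
have -> : inv_qfac q (k.+1 + l) k.+2 = (1 - q ^+ l) / qf q l by rewrite inv_qfacnS inv_qfacDl addKn.
have -> : inv_qfac q (k + m) k.+1 = (1 - q ^+ m) / qf q m by rewrite inv_qfacnS inv_qfacDl addKn.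
have -> : (k.+1 * k.+1 = (k * k + k + k).+1)%N by lia.
have -> : (2 * k.+1 = (k + k).+2)%N by lia.
have -> : (2 * k = k + k)%N by lia.
rewrite !inv_qfacDl /unit_pair binS bin1.
rewrite !(addSn, addnS, addn1, addn0) !qfS !(exprS, exprD, expr0).
field.
by rewrite -!exprD -!exprS -?addSn -?addnS !hq !qf_neq0.
Qed.

(** Once the range reaches past [minn L M], the boundary term of [seed_wz] vanishes, which leaves a
    first-order recurrence in [M]. *)
Lemma seed_sum L M n : (minn L M < n)%N ->
  \sum_(j < n) unit_pair j * q ^+ (j * j) * (inv_qfac q L j / qf q (L + j))
    * (inv_qfac q M j / qf q (M + j)) = (qf q L * qf q M * qf q (L + M))^-1.
Proof.
elim: M n => [|M IH] n.
  rewrite minn0; case: n => // n _.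
  rewrite big_ord_recl big1 => [|i _]; last by rewrite (@inv_qfac_small 0) // mul0r mulr0.
  by rewrite !addn0 !inv_qfacn0 mul0n qf0 /=; field; rewrite !qf_neq0 oner_neq0.
case: n => // k; rewrite ltnS => le_k; have := @seed_wz L M k; cbv zeta.
rewrite -mulrA; have -> : (inv_qfac q L k.+1 / qf q (L + k)) * (inv_qfac q M k / qf q (M.+1 + k)) = 0.
  case: (leqP L k) => [lt_k|lt_k]; first by rewrite (@inv_qfac_small L) ?mul0r.
  by rewrite (@inv_qfac_small M) ?mul0r ?mulr0 //; lia.
rewrite mulr0 big_split /= sumrN -mulr_sumr IH; last by lia.
have h1 : (1 - q ^+ M.+1) * (1 - q ^+ (L + M).+1) != 0 by rewrite mulf_neq0 // hq.
move/subr0_eq/(canRL (mulKf h1)) => ->.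
by rewrite addnS !qfS; field; rewrite !qf_neq0 !hq.
Qed.

(** [F_{x,y}] folded onto [j >= 0], since [B] is even under [(a,b) -> (-a,-b)]. The free cut-off
    lets sums with different [L], [M] share one range. *)
Definition burge_poly_upto x y L M n :=
  \sum_(j < n) unit_pair j * q ^+ (x * y * (j * j)) * qbinom2 L M (x * j) (y * j).

Definition burge_poly x y L M := burge_poly_upto x y L M (minn L M).+1.

Lemma burge_poly_uptoE x y L M n : (0 < x)%N -> (0 < y)%N -> (minn L M < n)%N ->
  burge_poly_upto x y L M n = burge_poly x y L M.
Proof.
move=> x0 y0 /subnKC <-; rewrite /burge_poly /burge_poly_upto big_split_ord /= [X in _ + X]big1 ?addr0 // => i _.
by rewrite qbinom2_small ?mulr0 //; apply/orP; nia.
Qed.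

Lemma burge_polyC x y L M : burge_poly x y L M = burge_poly y x M L.
Proof.
by rewrite /burge_poly minnC /burge_poly_upto; apply: eq_bigr => j _; rewrite qbinom2C (mulnC x y).
Qed.

Lemma burge_poly_seed L M : burge_poly 1 1 L M = qf q (L + M) / (qf q L * qf q M).
Proof.
transitivity (qf q (L + M) ^+ 2 * \sum_(j < (minn L M).+1) unit_pair j * q ^+ (j * j)
    * (inv_qfac q L j / qf q (L + j)) * (inv_qfac q M j / qf q (M + j))).
  rewrite mulr_sumr; apply: eq_bigr => j _.
  by rewrite /qbinom2 !mul1n addnK; ring.
by rewrite seed_sum //; field; rewrite !qf_neq0.
Qed.

(** After exchanging the sums, [burge] applies to each [j] with [a = xj], [b = yj]; the released
    factor [q^((yj)^2)] turns the coefficient [xy] of [j^2] into [(x+y)y]. *)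
Lemma burge_poly_step x y L M : (0 < x)%N -> (0 < y)%N ->
  burge_poly (x + y) y L M = \sum_(i < L.+1) q ^+ (i * i)
    * (qf q (2 * L + M - i) / qf q (2 * L) * inv_qfac q M i) * burge_poly x y (L - i) i.
Proof.
move=> x0 y0; rewrite -(@burge_poly_uptoE _ _ L M L.+1); [|lia..].
under [RHS]eq_bigr => i _.
  rewrite -(@burge_poly_uptoE _ _ _ _ L.+1); [|by case: i => i /=; lia..].
  rewrite mulr_sumr.
  under eq_bigr => j _ do rewrite mulrCA.
  over.
rewrite exchange_big; apply: eq_bigr => j _ /=.
rewrite -mulr_sumr burge -mulnDl [RHS]mulrA; congr (_ * _).
by rewrite -mulrA -exprD; congr (_ * _ ^+ _); lia.
Qed.

(** * The q-binomial theorem and a finite Jacobi triple product *)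

Lemma qbinomial_theorem (w z : K) n :
  \prod_(i < n) (w - z * q ^+ i) = \sum_(k < n.+1) (-1) ^+ k * z ^+ k * w ^+ (n - k)
    * q ^+ 'C(k, 2) * (qf q n / (qf q k * qf q (n - k))).
Proof.
transitivity (\sum_(k < n.+1) (-1) ^+ k * z ^+ k * w ^+ (n - k)
    * q ^+ 'C(k, 2) * (qf q n * inv_qfac q n k / qf q k)); last first.
  apply: eq_bigr => k _; rewrite /inv_qfac -ltnS ltn_ord; field.
  by rewrite !qf_neq0.
elim: n => [|n IH].
  by rewrite big_ord0 big_ord1 /= inv_qfacn0 qf0; field; rewrite oner_neq0.
pose t n k := (-1) ^+ k * z ^+ k * w ^+ (n - k)
    * q ^+ 'C(k, 2) * (qf q n * inv_qfac q n k / qf q k).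
rewrite big_ord_recr /= IH -/(\sum_(k < n.+2) t n.+1 k) -/(\sum_(k < n.+1) t n k).
have t_last : t n n.+1 = 0 by rewrite /t inv_qfac_small // mulr0 mul0r mulr0.
have tS k : (k <= n)%N -> t n.+1 k.+1 = w * t n k.+1 - z * q ^+ n * t n k.
  rewrite leq_eqVlt => /orP[/eqP ->|/subnKC].
    rewrite t_last /t inv_qfacSS /inv_qfac leqnn !subnn !qfS qf0 !exprS binS bin1 exprD.
    by field; rewrite !qf_neq0 -exprS hq oner_neq0.
  move: (n - k.+1)%N => j <-; rewrite /t.
  have -> : ((k.+1 + j).+1 - k.+1 = j.+1)%N by lia.
  have -> : (k.+1 + j - k.+1 = j)%N by lia.
  have -> : (k.+1 + j - k = j.+1)%N by lia.
  rewrite inv_qfacSS inv_qfacDl (_ : k.+1 + j = k + j.+1)%N ?inv_qfacDl; last by lia.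
  rewrite binS bin1 -!addSnnS !qfS !(addSn, exprS, exprD).
  by field; rewrite !qf_neq0 -!exprS !hq.
have t0 : t n.+1 0 = w * t n 0.
  by rewrite /t !inv_qfacn0 !subn0 !expr0 exprS qf0; field; rewrite !qf_neq0 oner_neq0.
rewrite [RHS]big_ord_recl t0 [X in _ = _ + X](eq_bigr (fun i : 'I_n.+1 => w * t n i.+1 - z * q ^+ n * t n i)).
  rewrite big_split /= sumrN -!mulr_sumr addrA -mulrDr -(big_ord_recl _ (t n)).
  by rewrite [in w * _]big_ord_recr /= t_last addr0; ring.
by move=> -[i lt_i] _; rewrite /= tS.
Qed.

End QAlgebra.

(** The weights are the p-binomials [[2n; n-j]]. They arise by expanding the product of the [2n]
    factors [p^n - x p^i] about its middle term; the homogeneous form of the q-binomial theorem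
    keeps all exponents nonnegative. *)
Lemma jacobi_finite (K : fieldType) (q : K) (k n : nat) :
  let p := q ^+ (2 * k).+1 in
  (forall m, 1 - p ^+ m.+1 != 0) -> q != 0 ->
  \sum_(j < n.+1) unit_pair q j * q ^+ (k * (j * j))
     * (qf p (n + n) * (inv_qfac p n j / qf p (n + j)))
  = qprod (q ^+ k) p n * qprod (q ^+ k.+1) p n.
Proof.
move=> p hp q0; set x := q ^+ k.+1; set y := q ^+ k.
have p0 : p != 0 by rewrite expf_neq0.
have x0 : x != 0 by rewrite expf_neq0.
have xy : x * y = p by rewrite -exprD; congr (_ ^+ _); lia.
(* [D] collects [-x p^i] from each of the first [n] factors and [p^n] from each of the last [n];
   what remains are the two products on the right. *)
pose D := (-1) ^+ n * x ^+ n * p ^+ (n * n + 'C(n, 2)).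
have D0 : D != 0 by rewrite /D !mulf_neq0 ?expf_neq0 ?oppr_eq0 ?oner_neq0.
apply: (mulfI D0).
have bin2E m : ('C(m, 2) * 2 + m = m * m)%N.
  by elim: m => [|m IH]; rewrite ?bin0n ?binS ?bin1 //; lia.
have prodE : \prod_(i < n + n) (p ^+ n - x * p ^+ i) = D * (qprod y p n * qprod x p n).
  rewrite big_split_ord /=.
  rewrite (eq_bigr (fun i : 'I_n => p ^+ i * (- x) * (1 - y * p ^+ (rev_ord i)))); last first.
    move=> [i /= lt_i] _.
    have -> : p ^+ n = x * y * p ^+ i * p ^+ (n - i.+1).
      by rewrite xy -exprS -exprD subnKC.
    by ring.
  rewrite 2!big_split /= prodr_const card_ord -expr_sum.
  rewrite [X in _ * X * _ = _](reindex_inj rev_ord_inj) /=.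
  under [X in _ * X * _ = _]eq_bigr => i _ do rewrite subnSK // subKn ?(ltnW (ltn_ord i)) //.
  rewrite -(big_mkord xpredT id) bin2_sum.
  under [X in _ * X = _]eq_bigr => i _ do
    rewrite exprD mulrCA -[X in X - _]mulr1 -mulrBr.
  rewrite big_split /= prodr_const card_ord exprNn -exprM /D exprD /qprod.
  by ring.
rewrite -prodE qbinomial_theorem // -addnS big_split_ord /=.
(* Reversing the lower half pairs the indices [n - j] and [n + j], which are the terms [-j] and [j]
   folded in [unit_pair]. *)
rewrite [X in _ = X + _](reindex_inj rev_ord_inj) big_ord_recl [X in _ = _ + X]big_ord_recl.
rewrite [RHS]addrCA -big_split mulrDr mulr_sumr; congr (_ + _).
  rewrite /unit_pair !muln0 !addn0 inv_qfacn0 addnK -exprM /D exprD !expr0 /=.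
  by field; rewrite !qf_neq0.
apply: eq_bigr => -[i /= lt_i] _; rewrite /bump leq0n add1n.
move/subnKC: lt_i; move: (n - i.+1)%N => h nE.
have -> : inv_qfac p n i.+1 = (qf p h)^-1 by rewrite -nE inv_qfacDl.
have -> : (n + n - h = n + i.+1)%N by lia.
have -> : (n + n - (n + i.+1) = h)%N by lia.
have bn := bin2E n; have bh := bin2E h; have bi := bin2E i; have bni := bin2E (n + i.+1)%N.
have E1 : x ^+ h * p ^+ n ^+ (n + i.+1) * p ^+ 'C(h, 2)
    = x ^+ n * p ^+ (n * n + 'C(n, 2)) * q ^+ (k * (i.+1 * i.+1) + 'C(i.+1, 2)).
  rewrite /x /p -!exprM -!exprD; congr (_ ^+ _); rewrite binS bin1; nia.
have E2 : x ^+ (n + i.+1) * p ^+ n ^+ h * p ^+ 'C(n + i.+1, 2)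
    = x ^+ n * p ^+ (n * n + 'C(n, 2)) * q ^+ (k * (i.+1 * i.+1) + 'C(i.+1, 2) + i.+1).
  rewrite /x /p -!exprM -!exprD; congr (_ ^+ _); rewrite binS bin1; nia.
have S1 : (-1) ^+ h = (-1) ^+ n * (-1) ^+ i.+1 :> K.
  by rewrite -nE exprD mulrAC -expr2 sqrr_sign mul1r.
have S2 : (-1) ^+ (n + i.+1) = (-1) ^+ n * (-1) ^+ i.+1 :> K by rewrite exprD.
have assoc (u1 u2 u3 u4 u5 : K) : u1 * u2 * u3 * u4 * u5 = u1 * (u2 * u3 * u4) * u5 by ring.
rewrite [in RHS]assoc [in RHS](assoc _ (x ^+ (n + i.+1))) E1 E2 S1 S2 /D /unit_pair !exprD.
by field; rewrite !qf_neq0.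
Qed.

(** * Chains of Burge steps *)

Section Chains.
Variables (K : fieldType) (q : K).
Hypothesis hq : forall n, 1 - q ^+ n.+1 != 0.

(** With [L = m_j], [l = m_(j+1)], these terms remain after completing squares in [m^T C m]; [f]
    tells whether [j] is some [t_i]. The second branch is [(L - l)^2], as at most one truncated
    difference is nonzero. *)
Definition step_exp (f : bool) (L l : nat) : nat :=
  if f then (l * l)%N else ((L - l) * (L - l) + (l - L) * (l - L))%N.

(** The factor [[2m_j + n_j; 2m_j]] with [u, L, l] for [m_(j-1), m_j, m_(j+1)]: here [n_j] is
    [u - L - l] at some [t_i] and [u + l - 2L] elsewhere. *)
Definition step_qbin (f : bool) (u L l : nat) : K :=
  if f then qf q (L + u - l) / qf q (2 * L) * inv_qfac q u (L + l)
  else qf q (u + l) / qf q (2 * L) * inv_qfac q (u + l) (2 * L).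

Fixpoint chain_sum N s u L : K :=
  if s is f :: s' then \sum_(l < N) q ^+ step_exp f L l * step_qbin f u L l * chain_sum N s' L l
  else qf q u / qf q L * inv_qfac q u L.

(** A swap factor forces [L + l <= u]. Otherwise [l > L] kills the tail by induction, and [l <= L]
    gives [u + l < 2L]. *)
Lemma chain_sum_small N s u L : (u < L)%N -> chain_sum N s u L = 0.
Proof.
elim: s u L => [|f s IH] u L lt_uL /=; first by rewrite inv_qfac_small // mulr0.
apply: big1 => -[l /= _] _; case: f => /=.
  by rewrite /step_qbin inv_qfac_small; [ring|lia].
case: (ltnP L l) => [/IH -> |le_lL]; first by rewrite mulr0.
by rewrite /step_qbin inv_qfac_small; [ring|lia].
Qed.

Lemma chain_sum_cons N f s u L : (L < N)%N ->
  chain_sum N (f :: s) u L = \sum_(l < L.+1) q ^+ step_exp f L l * step_qbin f u L l * chain_sum N s L l.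
Proof.
move=> lt_LN /=; rewrite -(subnKC lt_LN) big_split_ord /= [X in _ + X]big1 ?addr0 // => i _.
by rewrite chain_sum_small ?mulr0 //; lia.
Qed.

(** [chain_sum N s u L] stands for the sum over the variables following
    [m_j = L], where [m_(j-1) = u] and [s] records which later indices are of
    the form [t_i]; the truncation of the variables at [N] is harmless since
    nonzero terms are nonincreasing in [j]. *)
Definition computes_burge N s x y :=
  forall u L, (L <= u)%N -> (L < N)%N -> chain_sum N s u L = burge_poly q x y L (u - L).

Lemma computes_burge_nil N : computes_burge N [::] 1 1.
Proof.
move=> u L le_Lu lt_LN; rewrite burge_poly_seed // subnKC //= /inv_qfac le_Lu.
by field; rewrite !qf_neq0.
Qed.

(** The next variable is [l = L - i] for the Burge index [i], so [F_{x,y}(L-i, i)] is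
    [F_{x,y}(l, L-l)] and the pair keeps its order. *)
Lemma computes_burge_false N s x y : (0 < x)%N -> (0 < y)%N ->
  computes_burge N s x y -> computes_burge N (false :: s) (x + y) y.
Proof.
move=> x0 y0 hs u L /subnKC; move: (u - L)%N => M <- lt_LN.
rewrite chain_sum_cons // burge_poly_step // (reindex_inj rev_ord_inj) /=.
apply: eq_bigr => -[i /=]; rewrite ltnS => le_iL _; rewrite subSS.
rewrite hs ?leq_subr //; last exact: leq_ltn_trans (leq_subr _ _) lt_LN.
rewrite subKn // (_ : L - i - L = 0)%N ?addn0; last by lia.
rewrite (_ : L + M + (L - i) = 2 * L + M - i)%N; last by lia.
congr (_ * (_ * _) * _).
case: (leqP i M) => le_iM; last by rewrite !inv_qfac_small //; lia.
by rewrite (_ : 2 * L + M - i = 2 * L + (M - i))%N ?inv_qfacDl /inv_qfac ?le_iM //; lia.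
Qed.

(** Here [l = i], so the tail has arguments [(i, L - i)] and the symmetry of the Burge polynomials
    swaps the pair. *)
Lemma computes_burge_true N s x y : (0 < x)%N -> (0 < y)%N ->
  computes_burge N s y x -> computes_burge N (true :: s) (x + y) y.
Proof.
move=> x0 y0 hs u L /subnKC; move: (u - L)%N => M <- lt_LN.
rewrite chain_sum_cons // burge_poly_step //.
apply: eq_bigr => -[i /=]; rewrite ltnS => le_iL _.
rewrite hs //; last exact: leq_ltn_trans le_iL lt_LN.
rewrite [burge_poly q y x _ _]burge_polyC.
rewrite (_ : L + (L + M) - i = 2 * L + M - i)%N; last by lia.
by congr (_ * (_ * _) * _); rewrite /inv_qfac leq_add2l subnDl.
Qed.

Lemma computes_burge_nseq N s x y k : (0 < x)%N -> (0 < y)%N ->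
  computes_burge N s x y -> computes_burge N (nseq k false ++ s) (k * y + x) y.
Proof.
move=> x0 y0 hs; elim: k => [|k IH] //=.
rewrite (_ : k.+1 * y + x = k * y + x + y)%N; last by rewrite mulSn; lia.
by apply: computes_burge_false IH => //; lia.
Qed.

End Chains.

(** [nth false (flags (cf a b)) (j-1)] tells whether [j] is some [t_i], for
    [0 < j < d]. *)
Fixpoint flags (l : seq nat) : seq bool :=
  if l is a :: l' then nseq a.-1 false ++ (if l' is [::] then [::] else true :: flags l')
  else [::].

(** Induction along the Euclidean algorithm. A quotient [k] contributes [k - 1] plain steps,
    preceded in the build-up by one swapping step out of [(r, p mod r)], or by the seed [(1,1)] when
    [r] divides [p], that is, when [r = 1]. *)
Lemma flags_computes_burge (K : fieldType) (q : K) N f p r :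
    (forall n, 1 - q ^+ n.+1 != 0) ->
    (0 < r <= p)%N -> (r <= f)%N -> coprime p r ->
  computes_burge q N (flags (cf_aux f p r)) p r.
Proof.
move=> hq; elim: f p r => [|f IH] p r; first by case: r.
move=> /andP[r0 le_rp] le_rf co_pr /=.
have -> : (r == 0)%N = false by case: r r0 {le_rp le_rf co_pr}.
have k0 : (0 < p %/ r)%N by rewrite divn_gt0.
case: (posnP (p %% r)) => [p0|p0].
  have r1 : r = 1%N.
    by move: co_pr; rewrite /coprime; move/eqP: p0; rewrite -/(dvdn r p) => /gcdn_idPr -> /eqP.
  have -> : cf_aux f r (p %% r) = [::] by case: (f) => //= g; rewrite p0.
  have pE : p = (p.-1 * 1 + 1)%N by move: k0; rewrite r1 divn1; lia.
  rewrite r1 divn1 [X in computes_burge _ _ _ X _]pE.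
  by apply: computes_burge_nseq => //; exact: computes_burge_nil.
have := IH r (p %% r)%N; case E: (cf_aux f r (p %% r)) => [|b l] h.
  case: (f) E le_rf => [|g /=]; last by case: (p %% r)%N p0.
  by move=> _ r1; move: p0; rewrite (_ : r = 1%N) ?modn1 //; lia.
rewrite {2}(divn_eq p r) (_ : p %/ r * r + p %% r = (p %/ r).-1 * r + (p %% r + r))%N; last first.
  by case: (p %/ r)%N k0 => // k _ /=; rewrite mulSn; lia.
apply: computes_burge_nseq => //; first by lia.
apply: computes_burge_true => //; apply: h.
- by rewrite p0 ltnW ?ltn_mod.
- by have := ltn_pmod p r0; lia.
- by rewrite coprime_modr coprime_sym.
Qed.

(** * Partial quotients and the positions [t_j] *)

Lemma cf_aux_gt0 f p r : (0 < r <= p)%N -> all (leq 1) (cf_aux f p r).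
Proof.
elim: f p r => //= f IH p r /andP[r0 le_rp]; case: eqP => // _ /=.
rewrite divn_gt0 // le_rp /=; case: (posnP (p %% r)) => p0; last first.
  by apply: IH; rewrite p0 ltnW ?ltn_mod.
by case: (f) => //= g; rewrite p0.
Qed.

Definition tsum (l : seq nat) j := (\sum_(i < j) nth 0 l i)%N.

Lemma flags_size l : all (leq 1) l -> l != [::] -> (size (flags l)).+1 = tsum l (size l).
Proof.
elim: l => // a l IH /= /andP[a0 al] _; rewrite /tsum big_ord_recl /= size_cat size_nseq.
case: l al IH => [|b l] al IH; first by rewrite big_ord0 /=; lia.
by have := IH al isT; rewrite /tsum => /= <-; lia.
Qed.

Lemma flags_nth l j : all (leq 1) l -> l != [::] -> (0 < j <= size (flags l))%N ->
  nth false (flags l) j.-1 = (j \in [seq tsum l k | k <- iota 1 (size l)]).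
Proof.
elim: l j => // a l IH j /= /andP[a0 al] _.
rewrite size_cat size_nseq nth_cat size_nseq inE {1}/tsum big_ord1 /=.
rewrite (iotaDl 1 1) -map_comp => hj.
have E : map (tsum (a :: l) \o addn 1) (iota 1 (size l)) = map (addn a) (map (tsum l) (iota 1 (size l))).
  by rewrite -map_comp; apply: eq_map => k /=; rewrite /tsum big_ord_recl.
rewrite E; case: (ltnP j a) => lt_ja.
  rewrite nth_nseq ifT; last by lia.
  rewrite ifT; last by lia.
  symmetry; apply/negbTE; rewrite negb_or; apply/andP; split; first by lia.
  by apply/mapP => -[k _ Ej]; lia.
rewrite ifF; last by lia.
case: l al IH E hj => [|b l] al IH E /=; first by lia.
case: (eqVneq j a) => [->|ne_ja]; first by rewrite subnn.
move=> hj; have -> : (j.-1 - a.-1 = (j - a).-1.+1)%N by lia.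
rewrite [LHS]/= IH //; last by move: hj; rewrite /=; lia.
by rewrite orFb -[LHS](mem_map (@addnI a)) subnKC.

Qed.

(** * Box sums and the quadratic form *)

(** Lists as arguments let the variables be peeled off one at a time from the front. *)
Fixpoint bsum (K : nmodType) (N n : nat) (G : seq nat -> K) : K :=
  if n is n'.+1 then \sum_(i < N) bsum N n' (fun s => G (val i :: s)) else G [::].

Lemma eq_bsum (K : nmodType) N n (G H : seq nat -> K) :
  (forall s, size s = n -> G s = H s) -> bsum N n G = bsum N n H.
Proof.
elim: n G H => [|n IH] G H h /=; first exact: h.
by apply: eq_bigr => i _; apply: IH => s hs; apply: h; rewrite /= hs.
Qed.

Lemma bsum_mull (K : pzRingType) N n c (G : seq nat -> K) :
  c * bsum N n G = bsum N n (fun s => c * G s).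
Proof.
elim: n G => [|n IH] G //=; rewrite mulr_sumr; apply: eq_bigr => i _.
by rewrite IH.
Qed.

Lemma bsum_sum (K : nmodType) N n m (G : nat -> seq nat -> K) :
  bsum N n (fun s => \sum_(i < m) G i s) = \sum_(i < m) bsum N n (G i).
Proof.
elim: n G => [|n IH] G //=; rewrite exchange_big; apply: eq_bigr => i _ /=.
exact: (IH (fun j s => G j (val i :: s))).
Qed.

(** A function on [d + 1] points is its first value together with a function on the remaining [d],
    which matches one layer of [bsum]; the extra head [0] makes the indexing 1-based. *)
Lemma ffun_bsum (K : nmodType) d N (G : (nat -> nat) -> K) :
  \sum_(f : {ffun 'I_d -> 'I_N}) G (ext_vec f) = bsum N d (fun s => G (nth 0%N (0%N :: s))).
Proof.
elim: d G => [|d IH] G.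
  have f0 : {ffun 'I_0 -> 'I_N} by apply: finfun => -[].
  rewrite (big_pred1 f0) /=; last first.
    by move=> f; symmetry; apply/eqP/ffunP => -[].
  congr G; apply/funext => -[|j] //=.
  by rewrite insubF ?nth_nil.
pose h (p : 'I_N * {ffun 'I_d -> 'I_N}) : {ffun 'I_d.+1 -> 'I_N} :=
  [ffun j => if unlift ord0 j is Some j' then p.2 j' else p.1].
rewrite (reindex h) /=; last first.
  exists (fun f : {ffun 'I_d.+1 -> 'I_N} => (f ord0, [ffun j => f (lift ord0 j)])).
    move=> [i g] _; rewrite /h /= ffunE unlift_none; congr pair.
    by apply/ffunP => j; rewrite !ffunE liftK.
  move=> f _; apply/ffunP => j; rewrite ffunE /=.
  by case: unliftP => [j'|] ->; rewrite ?ffunE.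
rewrite -(pair_big xpredT xpredT (fun i g => G (ext_vec (h (i, g))))) /=.
apply: eq_bigr => i _.
pose G' (v : nat -> nat) :=
  G (fun j => match j with 0 => 0%N | 1 => val i | j'.+2 => v j'.+1 end).
transitivity (\sum_(g : {ffun 'I_d -> 'I_N}) G' (ext_vec g)).
  apply: eq_bigr => g _; congr G; apply/funext => -[|[|j]] //=.
    rewrite insubT //= (_ : Sub 0%N _ = ord0); last exact: val_inj.
    by rewrite ffunE unlift_none.
  case: insubP => [j' lt_j Ej|]; case: insubP => [j'' lt_j' Ej'|] //=.
  - rewrite ffunE; have -> : j' = lift ord0 j'' by apply: val_inj; rewrite /= Ej Ej'.
    by rewrite liftK.
  - by rewrite -ltnS lt_j.
  - by rewrite ltnS lt_j'.
rewrite IH; apply: eq_bsum => s _; congr G; apply/funext => -[|[|j]] //.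
Qed.

Section Weights.
Variables (K : fieldType) (q : K).

(** The summand of [chain_sum]: [v 0] is [u], [v 1] is [L], and the summation variables start at
    [v 2]. *)
Definition chain_weight (s : seq bool) (v : nat -> nat) : K :=
  q ^+ (\sum_(i < size s) step_exp (nth false s i) (v i.+1) (v i.+2))%N
  * (\prod_(i < size s) step_qbin q (nth false s i) (v i) (v i.+1) (v i.+2))
  * (qf q (v (size s)) / qf q (v (size s).+1) * inv_qfac q (v (size s)) (v (size s).+1)).

Lemma chain_weight_cons f s v :
  chain_weight (f :: s) v = q ^+ step_exp f (v 1) (v 2) * step_qbin q f (v 0) (v 1) (v 2)
                  * chain_weight s (fun j => v j.+1).
Proof. by rewrite /chain_weight /= !big_ord_recl exprD /=; ring. Qed.

Lemma chain_sum_bsum N s u L :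
  chain_sum q N s u L = bsum N (size s) (fun r => chain_weight s (nth 0%N [:: u, L & r])).
Proof.
elim: s u L => [|f s IH] u L /=.
  by rewrite /chain_weight !big_ord0 expr0 !mul1r.
apply: eq_bigr => l _; rewrite IH bsum_mull; apply: eq_bsum => r _.
by rewrite chain_weight_cons.
Qed.

(** The limit of [chain_sum N s u L] as [u] tends to infinity. *)
Definition chain_series N (s : seq bool) L : K :=
  if s is f :: s' then (qf q (2 * L))^-1 * \sum_(l < N) q ^+ step_exp f L l * chain_sum q N s' L l
  else (qf q L)^-1.

Definition series_weight (s : seq bool) (v : nat -> nat) : K :=
  if s is f :: s' then (qf q (2 * v 0))^-1 * (q ^+ step_exp f (v 0) (v 1) * chain_weight s' v)
  else (qf q (v 0))^-1.

Lemma chain_series_bsum N s L :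
  chain_series N s L = bsum N (size s) (fun r => series_weight s (nth 0%N (L :: r))).
Proof.
case: s => [|f s] //=; rewrite mulr_sumr; apply: eq_bigr => l _.
by rewrite chain_sum_bsum !bsum_mull.
Qed.

End Weights.

Lemma sum_delta (m n c : nat) (g : nat -> int) :
  \sum_(m <= k < n) (c == k)%:Z * g k = if (m <= c < n)%N then g c else 0.
Proof.
case: ifP => [|/negbT hc].
  move=> /andP[h1 h2]; rewrite (big_cat_nat h1 (ltnW h2)) /= (big_ltn h2) eqxx mul1r.
  rewrite !big_nat !big1 ?addr0 ?add0r // => k hk; rewrite (_ : (c == k) = false) ?mul0r //; lia.
rewrite big_nat big1 // => k hk; rewrite (_ : (c == k) = false) ?mul0r //.
by apply/negP => /eqP E; rewrite E hk in hc.
Qed.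

(** * Row sums of [C] and completion of squares *)

Section Rows.
Variables (a b o : nat) (x : nat -> nat).
Let d := cfd a b.
(** Extension by zero removes the missing neighbours [m_o] and [m_(d+1)] from the row sums; the
    offset [o] will be [0] or [a_0]. *)
Let X k : int := if (o < k <= d)%N then (x k)%:Z else 0.

Lemma row_sum j : (0 < j)%N ->
  \sum_(o.+1 <= k < d.+1) Cmat a b j k * (x k)%:Z
  = if is_t a b j then X j - X j.-1 + X j.+1 else 2 * X j - X j.-1 - X j.+1.
Proof.
move=> j0.
have E c : \sum_(o.+1 <= k < d.+1) (c == k)%:Z * (x k)%:Z = X c by rewrite sum_delta.
have E' : \sum_(o.+1 <= k < d.+1) (k.+1 == j)%:Z * (x k)%:Z = X j.-1.
  by rewrite -E; apply: eq_bigr => k _; congr (_%:Z * _); lia.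
case: ifP => tj.
  transitivity (\sum_(o.+1 <= k < d.+1) ((j == k)%:Z * (x k)%:Z
     - (k.+1 == j)%:Z * (x k)%:Z + (j.+1 == k)%:Z * (x k)%:Z)).
    by apply: eq_bigr => k _; rewrite /Cmat /Imat tj; ring.
  by rewrite !big_split /= sumrN !E E'.
transitivity (\sum_(o.+1 <= k < d.+1) (2 * ((j == k)%:Z * (x k)%:Z)
     - (k.+1 == j)%:Z * (x k)%:Z - (j.+1 == k)%:Z * (x k)%:Z)).
  by apply: eq_bigr => k _; rewrite /Cmat /Imat tj; ring.
by rewrite !big_split /= !sumrN -mulr_sumr !E E'.
Qed.

Lemma step_expE f L l : (step_exp f L l)%:Z = if f then l%:Z * l%:Z else (L%:Z - l%:Z) * (L%:Z - l%:Z).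
Proof.
rewrite /step_exp; case: f => //.
by case: (leqP L l) => h; nia.
Qed.

(** The trailing term of row [e] combines with the subdiagonal entry of row [e + 1] to form
    [step_exp]. At [e = d], which is some [t_i], it vanishes since [X (d+1) = 0]. *)
Lemma quad_partial e : (o < e <= d)%N ->
  \sum_(o.+1 <= j < e.+1) (x j)%:Z * \sum_(o.+1 <= k < d.+1) Cmat a b j k * (x k)%:Z
  = (x o.+1 * x o.+1 + \sum_(o.+1 <= j < e) step_exp (is_t a b j) (x j) (x j.+1))%N%:Z
    + (if is_t a b e then X e * X e.+1 else X e * X e - X e * X e.+1).
Proof.
case/andP=> /subnKC <-; move: (e - o.+1)%N => i; elim: i => [|i IH] hi.
  move: hi; rewrite addn0 => hi.
  rewrite big_nat1 [in RHS]big_geq // addn0 row_sum //=.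
  have X0 : X o = 0 by rewrite /X ltnn.
  have X1 : X o.+1 = (x o.+1)%:Z by rewrite /X ltnSn hi.
  by rewrite X0 X1 PoszM; case: ifP => _; ring.
have le1 : (o.+1 <= (o.+1 + i).+1)%N by lia.
rewrite addnS (big_nat_recr _ _ _ le1) /= IH; last by lia.
have le2 : (o.+1 <= o.+1 + i)%N by lia.
rewrite row_sum // (big_nat_recr _ _ _ le2) /= addnA (PoszD (_ + _)) step_expE.
have X1 : X (o.+1 + i) = (x (o.+1 + i))%:Z by rewrite /X ifT //; lia.
have X2 : X (o.+1 + i).+1 = (x (o.+1 + i).+1)%:Z by rewrite /X ifT //; lia.
rewrite -X1 -X2.
by case: (is_t a b (o.+1 + i)); case: (is_t _ _ _); ring.
Qed.

Lemma quadE : (o < d)%N -> is_t a b d ->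
  \sum_(o.+1 <= j < d.+1) \sum_(o.+1 <= k < d.+1) (x j)%:Z * Cmat a b j k * (x k)%:Z
  = (x o.+1 * x o.+1 + \sum_(o.+1 <= j < d) step_exp (is_t a b j) (x j) (x j.+1))%N%:Z.
Proof.
move=> lt_od td.
transitivity (\sum_(o.+1 <= j < d.+1) (x j)%:Z
   * \sum_(o.+1 <= k < d.+1) Cmat a b j k * (x k)%:Z).
  by apply: eq_bigr => j _; rewrite mulr_sumr; apply: eq_bigr => k _; rewrite mulrA.
by rewrite quad_partial ?lt_od ?leqnn // td {2}/X ltnn andbF mulr0 addr0.
Qed.
End Rows.

(** * The summands of the theorem as chain weights *)

Section Terms.
Variables (R : realType) (q : R[i]).

Lemma qbinE m (n : int) : qbin q (m%:Z + n) m%:Z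
  = if 0 <= n then qf q (m + absz n) / (qf q m * qf q (absz n)) else 0.
Proof.
rewrite /qbin le0z_nat addrC addKr /=; by case: n.
Qed.

Lemma step_qbinE f u L l : qbin q ((2 * L)%N%:Z
    + (if f then u%:Z - L%:Z - l%:Z else u%:Z + l%:Z - 2 * L%:Z)) (2 * L)%N%:Z
  = step_qbin q f u L l.
Proof.
rewrite qbinE /step_qbin; case: f.
  case: ifPn => h; last by rewrite inv_qfac_small ?mulr0 //; lia.
  have [n ->] : exists n, u = (L + l + n)%N by exists (u - (L + l))%N; lia.
  have -> : absz ((L + l + n)%N%:Z - L%:Z - l%:Z)%R = n by lia.
  have -> : (L + (L + l + n) - l = 2 * L + n)%N by lia.
  by rewrite inv_qfacDl invfM mulrA.
case: ifPn => h; last by rewrite inv_qfac_small ?mulr0 //; lia.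
have -> : (u + l = 2 * L + absz (u%:Z + l%:Z - 2 * L%:Z)%R)%N by lia.
by rewrite inv_qfacDl invfM mulrA.
Qed.

(** The part shared by both cases: [o = 0] gives [term_le], and [o = a_0] the contribution of the
    variables [m_j] to [term_gt]. *)
Definition core a b o (x : nat -> nat) : R[i] :=
  let d := cfd a b in
  let C := Cmat a b in
  q ^ (\sum_(o.+1 <= j < d.+1) \sum_(o.+1 <= k < d.+1) (x j)%:Z * C j k * (x k)%:Z)
    / qfac q (tau a b o.+1 * x o.+1)%N
    * \prod_(o.+2 <= j < d.+1)
        qbin q ((tau a b j * x j)%N%:Z - \sum_(o.+1 <= k < d.+1) C j k * (x k)%:Z)
          (tau a b j * x j)%N%:Z.

Lemma coreE a b o x s : (cfd a b = o + (size s).+1)%N -> is_t a b (cfd a b) ->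
    (forall i, (i < size s)%N -> nth false s i = is_t a b (o.+1 + i)) ->
  core a b o x = q ^+ (x o.+1 * x o.+1) * series_weight q s (fun i => x (o.+1 + i)%N).
Proof.
move=> dE td hs; rewrite /core quadE //; last by lia.
case: s dE hs => [|f s] dE hs.
  rewrite dE addn1 !big_geq // addn0 /tau dE addn1 ltnn mul1n /= addn0 mulr1.
  by [].
have hX c : (o < c <= cfd a b)%N ->
    (if (o < c <= cfd a b)%N then (x c)%:Z else 0) = (x c)%:Z by move=> ->.
have hd j : (o < j < cfd a b)%N -> tau a b j = 2%N.
  by move=> hj; rewrite /tau ifT //; lia.
rewrite hd; last by rewrite dE /=; lia.
rewrite -exprnP exprD /series_weight /chain_weight addn0 /=.
have -> : (\sum_(o.+1 <= j < cfd a b) step_exp (is_t a b j) (x j) (x j.+1)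
   = step_exp f (x o.+1) (x (o.+1 + 1)) + \sum_(i < size s)
      step_exp (nth false s i) (x (o.+1 + i.+1)) (x (o.+1 + i.+2)))%N.
  rewrite -[o.+1 in LHS]add0n big_addn big_mkord.
  have -> : (cfd a b - o.+1 = (size s).+1)%N by rewrite dE /=; lia.
  rewrite big_ord_recl /= (_ : is_t a b _ = f); last first.
    by have := hs 0%N isT; rewrite addn0 add0n => <-.
  rewrite add0n addn1; congr (_ + _)%N; apply: eq_bigr => -[i /= lt_i] _.
  rewrite /bump leq0n (_ : (1 + i + o.+1)%N = (o.+1 + i.+1)%N); last by lia.
  by rewrite -hs //= !addnS.
have -> : \prod_(o.+2 <= j < (cfd a b).+1)
        qbin q ((tau a b j * x j)%N%:Z - \sum_(o.+1 <= k < (cfd a b).+1) Cmat a b j k * (x k)%:Z)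
          (tau a b j * x j)%N%:Z
  = (\prod_(i < size s) step_qbin q (nth false s i) (x (o.+1 + i)%N) (x (o.+1 + i.+1)%N) (x (o.+1 + i.+2)%N))
    * (qf q (x (o.+1 + size s)%N) / qf q (x (o.+1 + (size s).+1)%N)
       * inv_qfac q (x (o.+1 + size s)%N) (x (o.+1 + (size s).+1)%N)).
  rewrite -[o.+2 in LHS]add0n big_addn big_mkord.
  have -> : ((cfd a b).+1 - o.+2 = (size s).+1)%N by rewrite dE /=; lia.
  rewrite big_ord_recr /=; congr (_ * _).
    apply: eq_bigr => -[i /= lt_i] _.
    rewrite hd; last by rewrite dE /=; lia.
    rewrite (_ : (i + o.+2)%N = (o.+1 + i.+1)%N); last by lia.
    rewrite -step_qbinE; congr (qbin q (_ + _) _).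
    rewrite row_sum // -hs //=.
    rewrite !hX; [|rewrite dE /=; lia..].
    rewrite (_ : (o + i.+1 = o.+1 + i)%N); last by lia.
    rewrite -[(o.+1 + i.+1).+1]addnS.
    by case: ifP => _; ring.
  have -> : (size s + o.+2 = cfd a b)%N by rewrite dE /=; lia.
  have -> : (o.+1 + (size s).+1 = cfd a b)%N by rewrite dE /=; lia.
  have -> : (o.+1 + size s = (cfd a b).-1)%N by rewrite dE /=; lia.
  (* In the last row [d] is some [t_i], so [n_d = m_(d-1) - m_d]; with [tau_d = 1] this gives the
     closing binomial [[u; L]] of the chain. *)
  rewrite row_sum // ?td; last by lia.
  rewrite [X in _ - (_ + X)]ifF ?addr0; last by lia.
  rewrite !hX; [|rewrite dE /=; lia..].
  rewrite /tau ltnn mul1n qbinE.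
  have -> : - ((x (cfd a b))%:Z - (x (cfd a b).-1)%:Z) = (x (cfd a b).-1)%:Z - (x (cfd a b))%:Z by ring.
  case: ifPn => h; last by rewrite inv_qfac_small ?mulr0 //; lia.
  have [n ->] : exists n, x (cfd a b).-1 = (x (cfd a b) + n)%N.
    by exists (x (cfd a b).-1 - x (cfd a b))%N; lia.
  by rewrite PoszD addrC addKr inv_qfacDl invfM mulrA.
have -> : qfac q (2 * x o.+1) = qf q (2 * x o.+1) by [].
rewrite exprD; ring.
Qed.
End Terms.

(** * Limits in R[i] *)

Section ComplexLimits.
Variable R : realType.
Notation nm := (@Normc.normc R).
Implicit Types (z w l : R[i]) (u v : nat -> R[i]).

Lemma nmE z : `|z| = (nm z)%:C%C. Proof. by []. Qed.

Lemma nm_ge0 z : 0 <= nm z.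
Proof. by case: z => a b; exact: sqrtr_ge0. Qed.

Lemma nm_natX z n : nm (z ^+ n) = nm z ^+ n.
Proof.
elim: n => [|n IH]; first by rewrite !expr0; exact: Normc.normc1.
by rewrite !exprS Normc.normcM IH.
Qed.

Lemma nm_prod n (f : 'I_n -> R[i]) : nm (\prod_(i < n) f i) = \prod_(i < n) nm (f i).
Proof.
elim: n f => [|n IH] f; first by rewrite !big_ord0; exact: Normc.normc1.
by rewrite !big_ord_recr /= Normc.normcM IH.
Qed.

Lemma nm_sum n (f : 'I_n -> R[i]) : nm (\sum_(i < n) f i) <= \sum_(i < n) nm (f i).
Proof.
elim: n f => [|n IH] f; first by rewrite !big_ord0 Normc.normc0.
by rewrite !big_ord_recr /=; apply: le_trans (le_normcD _ _) _; rewrite lerD2r.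
Qed.

Lemma nm_distC z w : nm (z - w) = nm (w - z).
Proof. by rewrite -normcN opprB. Qed.

Lemma cvgC_eps u l : cvgC u l <->
  forall e : R, 0 < e -> exists N, forall n, (N <= n)%N -> nm (u n - l) < e.
Proof.
split.
  move=> h e e0; have h1 := (cvgrPdist_lt _ _).1 h.
  have /h1 [N _ hN] : 0 < e%:C%C :> R[i] by rewrite ltcR.
  exists N => n le_Nn; rewrite nm_distC -ltcR; exact: (hN n).
move=> h; apply: (cvgrPdist_lt _ _).2 => e e0.
(* In [R[i]] positivity makes the imaginary part zero, so the real part of [e] serves as the
   radius. *)
have e0' : 0 < complex.Re e by case: e e0 => a b; rewrite ltcE /= => /andP[].
have [N hN] := h _ e0'; exists N => // n /= le_Nn.
have -> : e = (complex.Re e)%:C%C by case: e e0 {e0' hN} => a b; rewrite ltcE /= => /andP[/eqP -> _].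
by rewrite nmE ltcR nm_distC hN.
Qed.

Lemma cvgC_cst l : cvgC (fun=> l) l.
Proof. exact: (@cvg_cst (R[i])^o). Qed.

Lemma cvgC_mul u v l m : cvgC u l -> cvgC v m -> cvgC (fun n => u n * v n) (l * m).
Proof. exact: (@cvgM R[i]). Qed.

Lemma cvgC_add u v l m : cvgC u l -> cvgC v m -> cvgC (fun n => u n + v n) (l + m).
Proof. exact: (@cvgD R[i] (R[i])^o). Qed.

Lemma cvgC_opp u l : cvgC u l -> cvgC (fun n => - u n) (- l).
Proof. exact: (@cvgN R[i] (R[i])^o). Qed.

Lemma cvgC_inv u l : l != 0 -> cvgC u l -> cvgC (fun n => (u n)^-1) l^-1.
Proof. exact: (@cvgV R[i]). Qed.

Lemma cvgC_sum k (f : nat -> nat -> R[i]) (g : nat -> R[i]) :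
  (forall j, (j < k)%N -> cvgC (f^~ j) (g j)) ->
  cvgC (fun n => \sum_(j < k) f n j) (\sum_(j < k) g j).
Proof.
elim: k => [|k IH] h.
  by under eq_fun do rewrite big_ord0; rewrite big_ord0; exact: cvgC_cst.
under eq_fun do rewrite big_ord_recr /=; rewrite big_ord_recr /=.
by apply: cvgC_add; [apply: IH => j /ltnW/h|exact: h].
Qed.

Lemma cvgC_uniq u l m : cvgC u l -> cvgC u m -> l = m.
Proof. by move=> h1 h2; exact: (cvg_unique (@norm_hausdorff _ (R[i])^o) h1 h2). Qed.

Lemma cvgC_lim u l : cvgC u l -> limC u = l.
Proof. by move=> h; exact: (cvg_lim (@norm_hausdorff _ (R[i])^o) h). Qed.

Lemma cvgC_eventually u v l c : (forall n, (c <= n)%N -> u n = v n) ->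
  cvgC u l -> cvgC v l.
Proof.
move=> h /cvgC_eps hu; apply/cvgC_eps => e /hu[N hN]; exists (maxn N c) => n.
by rewrite geq_max => /andP[h1 h2]; rewrite -h // hN.
Qed.

(** The condition is a form of divergence of [phi] that linear arithmetic can check for indices such
    as [2n + M - i]. *)
Lemma cvgC_comp u l c (phi : nat -> nat) : (forall n, (n <= phi n + c)%N) ->
  cvgC u l -> cvgC (fun n => u (phi n)) l.
Proof.
move=> h /cvgC_eps hu; apply/cvgC_eps => e /hu[N hN]; exists (N + c)%N => n le_n.
by apply: hN; have := h n; lia.
Qed.

Lemma cvgC_shift u l : cvgC (fun n => u n.+1) l -> cvgC u l.
Proof.
move=> /cvgC_eps hu; apply/cvgC_eps => e /hu[N hN]; exists N.+1 => -[|n] //.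
exact: hN.
Qed.

Lemma cvgC_dist0 u v l : cvgC (fun n => u n - v n) 0 -> cvgC v l -> cvgC u l.
Proof.
move=> h1 h2; have := cvgC_add h1 h2; rewrite add0r.
by under eq_fun do rewrite subrK.
Qed.

Lemma cvgC_dist0r u v l : cvgC (fun n => u n - v n) 0 -> cvgC u l -> cvgC v l.
Proof.
move=> /cvgC_opp h1 h2; have := cvgC_add h1 h2; rewrite oppr0 add0r.
by apply: (@cvgC_eventually _ _ _ 0%N) => n _; ring.
Qed.

Lemma cvgC_le0 u (b : nat -> R) : (forall e, 0 < e -> exists N, forall n, (N <= n)%N -> b n < e) ->
  (forall n, nm (u n) <= b n) -> cvgC u 0.
Proof.
move=> hb hu; apply/cvgC_eps => e /hb[N hN]; exists N => n /hN.
by rewrite subr0; apply: le_lt_trans.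
Qed.

Lemma cvgC_nm_le u l (B : R) : cvgC u l -> (forall n, nm (u n) <= B) -> nm l <= B.
Proof.
move=> /cvgC_eps hu hB; apply/ler_addgt0Pr => e /hu[N hN].
have -> : l = u N + - (u N - l) by ring.
apply: le_trans (le_normcD _ _) _; rewrite normcN lerD //; exact/ltW/hN.
Qed.

Lemma cvgC_nm_ge u l (B : R) : cvgC u l -> (forall n, B <= nm (u n)) -> B <= nm l.
Proof.
move=> /cvgC_eps hu hB; apply/ler_addgt0Pr => e /hu[N hN].
apply: le_trans (hB N) _; have {1}-> : u N = l + (u N - l) by ring.
apply: le_trans (le_normcD _ _) _; rewrite lerD2l; exact/ltW/hN.
Qed.

Variable rho : R.
Hypotheses (rho0 : 0 <= rho) (rho1 : rho < 1).

Lemma geom_small (e : R) : 0 < e -> exists N, forall n, (N <= n)%N -> rho ^+ n < e.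
Proof.
move=> e0; have : `|rho| < 1 by rewrite ger0_norm.
move/cvg_expr/cvgrPdist_lt => /(_ e e0) [N _ hN]; exists N => n /hN /=.
by rewrite sub0r normrN ger0_norm ?exprn_ge0.
Qed.

Lemma geom_sum n : \sum_(j < n) rho ^+ j <= (1 - rho)^-1.
Proof.
have h : 0 < 1 - rho by rewrite subr_gt0.
rewrite -[X in _ <= X]mul1r ler_pdivlMr // mulrC -opprB mulNr -subrX1 opprB.
by rewrite lerBlDr lerDl exprn_ge0.
Qed.

Lemma geom_tail m n : \sum_(j < n) rho ^+ (m + j) <= rho ^+ m / (1 - rho).
Proof.
under eq_bigr do rewrite exprD.
by rewrite -mulr_sumr ler_wpM2l ?exprn_ge0 ?geom_sum.
Qed.

(** Dominated convergence with a geometric majorant. Stated for a difference, it transfers a limit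
    in either direction between the two sums. *)
Lemma tannery (f : nat -> nat -> R[i]) (g : nat -> R[i]) (C : R) :
    (forall n j, nm (f n j) <= C * rho ^+ j) -> (forall j, cvgC (f^~ j) (g j)) ->
  cvgC (fun n => \sum_(j < n.+1) f n j - \sum_(j < n.+1) g j) 0.
Proof.
move=> hf hg; have hG j : nm (g j) <= C * rho ^+ j by apply: (cvgC_nm_le (hg j)).
have C0 : 0 <= C by have := le_trans (nm_ge0 _) (hG 0%N); rewrite expr0 mulr1.
have r1 : 0 < 1 - rho by rewrite subr_gt0.
apply/cvgC_eps => e e0.
(* Chosen so that the tail bound [2C rho^J / (1 - rho)] is at most [e/2]; the [+ 1] keeps the
   divisor positive when [C = 0]. *)
pose e1 := e / 2 * (1 - rho) / (2 * C + 1).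
have e10 : 0 < e1 by rewrite /e1 !mulr_gt0 ?invr_gt0 //; lra.
have [J /(_ J (leqnn J)) hJ] := geom_small e10.
have : cvgC (fun n => \sum_(j < J) (f n j - g j)) (\sum_(j < J) (g j - g j)).
  apply: (@cvgC_sum J (fun n j => f n j - g j) (fun j => g j - g j)) => j _.
  by apply: cvgC_add => //; exact: cvgC_cst.
rewrite big1 => [|j _]; last by rewrite subrr.
move/cvgC_eps => /(_ (e / 2)) [|N hN]; first by lra.
exists (maxn N J) => n; rewrite geq_max => /andP[/hN h1 le_Jn].
rewrite subr0 in h1; rewrite subr0 -sumrB.
have -> : n.+1 = (J + (n.+1 - J))%N by lia.
rewrite big_split_ord /=; apply: le_lt_trans (le_normcD _ _) _.
rewrite [e]splitr; apply: ltr_leD => //.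
apply: le_trans (nm_sum _) _.
apply: (@le_trans _ _ (\sum_(j < n.+1 - J) 2 * C * rho ^+ (J + j))).
  apply: ler_sum => j _; apply: le_trans (le_normcD _ _) _; rewrite normcN.
  by have := hf n (J + j)%N; have := hG (J + j)%N; lra.
rewrite -mulr_sumr; apply: (@le_trans _ _ (2 * C * (rho ^+ J / (1 - rho)))).
  by rewrite ler_wpM2l ?geom_tail //; lra.
rewrite mulrA ler_pdivrMr //.
have : (2 * C + 1) * rho ^+ J <= e / 2 * (1 - rho).
  by rewrite -ler_pdivlMl 1?mulrC ?ltW //; lra.
by have := exprn_ge0 J rho0; nra.
Qed.

End ComplexLimits.

(** * Bounds and convergence of infinite products *)

Section QPochhammerLimits.
Variable R : realType.
Notation nm := (@Normc.normc R).
Variable rho : R.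
Hypotheses (rho0 : 0 <= rho) (rho1 : rho < 1).

(** Past an index [m] with [rho^m < (1 - rho)/2], the Weierstrass inequality bounds the remaining
    product below by one minus a sum that is at most [1/2]. *)
Lemma prod_geom_lower : exists2 d : R, 0 < d & forall n, d <= \prod_(i < n) (1 - rho ^+ i.+1).
Proof.
have r1 : 0 < 1 - rho by rewrite subr_gt0.
have f01 i : 0 < 1 - rho ^+ i.+1 <= 1.
  by rewrite subr_gt0 exprn_ilt1 // lerBlDr lerDl exprn_ge0.
have [m /(_ m (leqnn m)) hm] : exists N, forall n, (N <= n)%N -> rho ^+ n < (1 - rho) / 2.
  by apply: geom_small => //; lra.
pose P n := \prod_(i < n) (1 - rho ^+ i.+1).
have P0 n : 0 < P n by apply: prodr_gt0 => i _; case/andP: (f01 i).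
have Pdec m' k : P (m' + k)%N <= P m'.
  rewrite /P big_split_ord /= ler_piMr //; first exact/ltW/P0.
  apply: prodr_ile1 => i _; have /andP[h1 ->] := f01 (m' + i)%N.
  by rewrite ltW.
have sum_lower k : 1 - \sum_(i < k) rho ^+ (m + i).+1 <= \prod_(i < k) (1 - rho ^+ (m + i).+1).
  elim: k => [|k IH]; first by rewrite !big_ord0 subr0.
  rewrite !big_ord_recr /=.
  have /andP[h1 h2] := f01 (m + k)%N.
  have h3 : 0 <= \sum_(i < k) rho ^+ (m + i).+1 by apply: sumr_ge0 => i _; rewrite exprn_ge0.
  have h4 : 0 <= rho ^+ (m + k).+1 by rewrite exprn_ge0.
  nra.
exists (P m / 2) => [|n]; first by have := P0 m; lra.
have Pm := P0 m.
case: (leqP n m) => [/subnKC <-|/ltnW/subnKC <-].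
  by have := Pdec n (m - n)%N; have := P0 (n + (m - n))%N; rewrite /P; lra.
rewrite big_split_ord /= -/(P m) ler_pM2l //.
apply: le_trans (sum_lower _).
have : \sum_(i < n - m) rho ^+ (m + i).+1 <= rho ^+ m / (1 - rho).
  apply: le_trans (geom_tail rho0 rho1 m (n - m)).
  by apply: ler_sum => i _; rewrite exprS ler_piMl ?exprn_ge0 // ltW.
have : rho ^+ m / (1 - rho) <= 1 / 2.
  by rewrite ler_pdivrMr //; lra.
lra.
Qed.

(** Each factor has modulus at least [1 - t] and at most [1 + t <= 1/(1 - t)] with [t = rho^(i+1)],
    so one constant serves all [x], [p] and [n]. *)
Lemma qprod_bounds : exists2 K : R, 1 <= K & forall (x p : R[i]) n, nm x <= rho -> nm p <= rho ->
  nm (qprod x p n) <= K /\ K^-1 <= nm (qprod x p n).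
Proof.
have [d d0 hd] := prod_geom_lower.
have d1 : d <= 1 by have := hd 0%N; rewrite big_ord0.
exists d^-1 => [|x p n hx hp]; first by rewrite invf_ge1.
have f01 i : 0 < 1 - rho ^+ i.+1 <= 1.
  by rewrite subr_gt0 exprn_ilt1 // lerBlDr lerDl exprn_ge0.
have hz i : nm (x * p ^+ i) <= rho ^+ i.+1.
  rewrite Normc.normcM nm_natX exprS ler_pM ?nm_ge0 ?exprn_ge0 ?nm_ge0 //.
  by rewrite lerXn2r ?nnegrE ?nm_ge0.
have n1 : nm 1 = 1 by exact: Normc.normc1.
rewrite invrK nm_prod; split.
  apply: (@le_trans _ _ (\prod_(i < n) (1 - rho ^+ i.+1)^-1)); last first.
    rewrite prodfV lef_pV2 ?posrE ?hd //.
    exact: lt_le_trans (hd n).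
  apply: ler_prod => i _; rewrite nm_ge0 /=.
  have /andP[h1 h2] := f01 i; rewrite -[X in _ <= X]mul1r ler_pdivlMr //.
  have h3 : nm (1 - x * p ^+ i) <= 1 + rho ^+ i.+1.
    by apply: le_trans (le_normcD _ _) _; rewrite normcN n1 lerD2l.
  have h4 : 0 <= rho ^+ i.+1 by rewrite exprn_ge0.
  nra.
apply: le_trans (hd n) _; apply: ler_prod => i _.
have /andP[h1 h2] := f01 i; rewrite ltW //=.
have : nm 1 <= nm (1 - x * p ^+ i) + nm (x * p ^+ i).
  by apply: le_trans (le_normcD _ _); rewrite subrK.
by have := hz i; rewrite n1; lra.
Qed.

Lemma real_geom_cvg (u : nat -> R) (K : R) :
  (forall n, `|u n.+1 - u n| <= K * rho ^+ n) -> exists l : R,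
  forall e, 0 < e -> exists N, forall n, (N <= n)%N -> `|u n - l| < e.
Proof.
move=> hu.
have K0 : 0 <= K by have := le_trans (normr_ge0 _) (hu 0%N); rewrite expr0 mulr1.
have h1 : cvgn (series (fun n => u n.+1 - u n)).
  apply: normed_cvg; apply: (series_le_cvg (v_ := geometric K rho)) => //= n.
  - by rewrite mulr_ge0 ?exprn_ge0.
  - by apply: is_cvg_geometric_series; rewrite ger0_norm.
have E n : series (fun n => u n.+1 - u n) n = u n - u 0%N.
  by rewrite /series /= telescope_sumr.
exists (limn (series (fun n => u n.+1 - u n)) + u 0%N) => e e0.
have [N _ hN] := (cvgrPdist_lt _ _).1 h1 e e0; exists N => n /hN /=.
rewrite E distrC; congr (_ < _); congr `|_|; ring.
Qed.

(** Consecutive products differ by at most [K rho^n]; completeness of the reals is applied to real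
    and imaginary parts. This makes the [limC] in [qpoch_inf] a genuine limit. *)
Lemma qprod_cvg (x p : R[i]) : nm x <= rho -> nm p <= rho ->
  cvgC (fun n => qprod x p n) (qpoch_inf x p).
Proof.
move=> hx hp; have [K K1 hK] := qprod_bounds.
have ReIm (z : R[i]) : `|complex.Re z| <= nm z /\ `|complex.Im z| <= nm z.
  case: z => a b /=; rewrite -!sqrtr_sqr !ler_sqrt ?addr_ge0 ?sqr_ge0 //.
  by rewrite lerDl lerDr !sqr_ge0.
have hd n : nm (qprod x p n.+1 - qprod x p n) <= K * rho ^+ n.
  rewrite /qprod big_ord_recr /= -/(qprod x p n).
  have -> : qprod x p n * (1 - x * p ^+ n) - qprod x p n = - (qprod x p n * (x * p ^+ n)) by ring.
  rewrite normcN Normc.normcM ler_pM ?nm_ge0 //; first by case: (hK x p n hx hp).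
  rewrite Normc.normcM nm_natX -[X in _ <= X]mul1r ler_pM ?nm_ge0 ?exprn_ge0 ?nm_ge0 //.
    exact: le_trans hx (ltW rho1).
  by rewrite lerXn2r ?nnegrE ?nm_ge0.
have [lr hlr] : exists l : R, forall e, 0 < e -> exists N, forall n, (N <= n)%N ->
    `|complex.Re (qprod x p n) - l| < e.
  apply: (@real_geom_cvg _ K) => n; apply: le_trans (hd n).
  by apply: le_trans (ReIm _).1; rewrite raddfB.
have [li hli] : exists l : R, forall e, 0 < e -> exists N, forall n, (N <= n)%N ->
    `|complex.Im (qprod x p n) - l| < e.
  apply: (@real_geom_cvg _ K) => n; apply: le_trans (hd n).
  by apply: le_trans (ReIm _).2; rewrite raddfB.
have h : cvgC (fun n => qprod x p n) (lr +i* li)%C.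
  apply/cvgC_eps => e e0; have e2 : 0 < e / 2 by lra.
  have [N1 h1] := hlr _ e2; have [N2 h2] := hli _ e2; exists (maxn N1 N2) => n.
  rewrite geq_max => /andP[/h1 {}h1 /h2 {}h2].
  apply: (@le_lt_trans _ _ (`|complex.Re (qprod x p n) - lr| + `|complex.Im (qprod x p n) - li|)); last by lra.
  case: (qprod x p n) {h1 h2} => a b /=.
  rewrite -[X in _ <= X]ger0_norm ?addr_ge0 // -sqrtr_sqr ler_sqrt ?sqr_ge0 //.
  move: (a - lr) (b - li) => A B.
  by rewrite sqrrD !real_normK ?num_real // addrAC lerDl mulrn_wge0 // mulr_ge0.
suff -> : qpoch_inf x p = (lr +i* li)%C by [].
exact: (cvgC_lim h).
Qed.

End QPochhammerLimits.

(** The limit of [burge_poly q x y L M] as [L] tends to infinity. *)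
Definition burge_series (K : fieldType) (q : K) x y M : K :=
  \sum_(j < M.+1) unit_pair q j * q ^+ (x * y * (j * j)) * (inv_qfac q M (y * j) / qf q (M + y * j)).

(** * Passing to the limit in the Burge polynomials *)

Section Unit.
Variables (R : realType) (q : R[i]).
Notation nm := (@Normc.normc R).
Hypothesis q1 : `|q| < 1.

Lemma nm_lt1 : nm q < 1.
Proof. by move: q1; rewrite nmE -[1]/(1%:C%C) ltcR. Qed.

Lemma nm_le1 n : nm (q ^+ n) <= 1.
Proof. by rewrite nm_natX exprn_ile1 ?nm_ge0 // ltW // nm_lt1. Qed.

Lemma nm_expS n : nm (q ^+ n.+1) <= nm q.
Proof. by rewrite exprS Normc.normcM ler_piMr ?nm_ge0 ?nm_le1. Qed.

Lemma one_subX_neq0 (p : R[i]) n : nm p <= nm q -> 1 - p ^+ n.+1 != 0.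
Proof.
move=> hp; rewrite subr_eq0; apply/eqP => /(congr1 nm).
rewrite Normc.normc1 nm_natX => E; have : nm p ^+ n.+1 < 1.
  by rewrite exprn_ilt1 ?nm_ge0 // (le_lt_trans hp) // nm_lt1.
by rewrite -E ltxx.
Qed.

Let hq n : 1 - q ^+ n.+1 != 0 := one_subX_neq0 n (lexx _).

Let Q := qpoch_inf q q.

Lemma qpoch_inf_neq0 (p : R[i]) : nm p <= nm q -> qpoch_inf p p != 0.
Proof.
move=> hp; have [K K1 hK] := qprod_bounds (nm_ge0 q) nm_lt1.
have h := qprod_cvg (nm_ge0 q) nm_lt1 hp hp.
have : K^-1 <= nm (qpoch_inf p p) by apply: (cvgC_nm_ge h) => n; case: (hK p p n hp hp).
apply: contraTneq => ->; rewrite Normc.normc0 -ltNge invr_gt0; lra.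
Qed.

Lemma qf_lim (p : R[i]) c (phi : nat -> nat) : nm p <= nm q ->
  (forall n, (n <= phi n + c)%N) -> cvgC (fun n => qf p (phi n)) (qpoch_inf p p).
Proof. by move=> hp h; apply: (cvgC_comp h); apply: (qprod_cvg (nm_ge0 q) nm_lt1). Qed.

Lemma inv_qfac_lim (p : R[i]) c k (phi : nat -> nat) : nm p <= nm q ->
  (forall n, (n <= phi n + c)%N) -> cvgC (fun n => inv_qfac p (phi n) k) (qpoch_inf p p)^-1.
Proof.
move=> hp h; apply: (@cvgC_eventually _ (fun n => (qf p (phi n - k))^-1) _ _ (c + k)).
  by move=> n hn; rewrite /inv_qfac ifT //; have := h n; lia.
apply: cvgC_inv; first exact: qpoch_inf_neq0.
by apply: (@qf_lim _ (c + k)) => // n; have := h n; lia.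
Qed.

Lemma qbinom2_lim M a b c (phi : nat -> nat) : (forall n, (n <= phi n + c)%N) ->
  cvgC (fun n => qbinom2 q (phi n) M a b) (inv_qfac q M b / qf q (M + b)).
Proof.
move=> h; have Q0 := qpoch_inf_neq0 (lexx (nm q)).
have -> : inv_qfac q M b / qf q (M + b)
  = Q * Q * (Q^-1 * Q^-1) * (inv_qfac q M b / qf q (M + b)) by rewrite /Q; field; rewrite qf_neq0 //; exact: hq.
apply: cvgC_mul; last exact: cvgC_cst.
apply: cvgC_mul; first by apply: cvgC_mul;
  apply: (@qf_lim _ (c + a + b)) => // n; have := h n; lia.
apply: cvgC_mul; first exact: inv_qfac_lim h.
by apply: cvgC_inv => //; apply: (@qf_lim _ c) => // n; have := h n; lia.
Qed.

Lemma burge_poly_lim x y M c (phi : nat -> nat) : (0 < x)%N -> (0 < y)%N ->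
  (forall n, (n <= phi n + c)%N) -> cvgC (fun n => burge_poly q x y (phi n) M) (burge_series q x y M).
Proof.
(* The cut-off [M.+1] is independent of [n], so the limit is taken in a sum of fixed length. *)
move=> x0 y0 h; apply: (@cvgC_eventually _ (fun n => burge_poly_upto q x y (phi n) M M.+1) _ _ 0%N).
  by move=> n _; rewrite burge_poly_uptoE //; lia.
apply: (@cvgC_sum _ _ (fun n j => unit_pair q j * q ^+ (x * y * (j * j)) * qbinom2 q (phi n) M (x * j) (y * j))
  (fun j => unit_pair q j * q ^+ (x * y * (j * j)) * (inv_qfac q M (y * j) / qf q (M + y * j)))) => j _.
by apply: cvgC_mul; [exact: cvgC_cst|exact: qbinom2_lim h].
Qed.

Lemma burge_series_seed M : burge_series q 1 1 M = (qf q M)^-1.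
Proof.
have h n : (n <= n + 0)%N by rewrite addn0.
have Q0 := qpoch_inf_neq0 (lexx (nm q)).
apply: (cvgC_uniq (@burge_poly_lim 1 1 M 0 (fun n => n) isT isT h)).
apply: (@cvgC_eventually _ (fun n => qf q (n + M) / qf q n / qf q M) _ _ 0%N).
  by move=> n _; rewrite (burge_poly_seed hq) invfM mulrA.
rewrite -[X in cvgC _ X]mul1r -(divff Q0).
apply: cvgC_mul; last exact: cvgC_cst.
apply: cvgC_mul; first by apply: (@qf_lim _ 0) => // n; lia.
by apply: cvgC_inv => //; apply: (@qf_lim _ 0) => // n; lia.
Qed.

(** The Burge step as [L] tends to infinity: [[2L+M-i; 2L]] tends to [1/(q)_(M-i)], and the terms
    with [i > M] are zero. *)
Lemma burge_series_step x y M : (0 < x)%N -> (0 < y)%N ->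
  burge_series q (x + y) y M = \sum_(i < M.+1) inv_qfac q M i * (q ^+ (i * i) * burge_series q x y i).
Proof.
move=> x0 y0; have h n : (n <= n + 0)%N by rewrite addn0.
have xy0 : (0 < x + y)%N by lia.
have Q0 := qpoch_inf_neq0 (lexx (nm q)).
apply: (cvgC_uniq (@burge_poly_lim _ _ M 0 (fun n => n) xy0 y0 h)).
apply: (@cvgC_eventually _ (fun n => \sum_(i < M.+1) q ^+ (i * i)
    * (qf q (2 * n + M - i) / qf q (2 * n) * inv_qfac q M i) * burge_poly q x y (n - i) i) _ _ M).
  move=> n /subnKC <-; rewrite (burge_poly_step hq) //.
  rewrite -addSn [RHS]big_split_ord /= [X in _ + X]big1 ?addr0 // => i _.
  by rewrite inv_qfac_small ?(mulr0, mul0r) //; lia.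
apply: (@cvgC_sum _ _ (fun n i => q ^+ (i * i)
    * (qf q (2 * n + M - i) / qf q (2 * n) * inv_qfac q M i) * burge_poly q x y (n - i) i)
  (fun i => inv_qfac q M i * (q ^+ (i * i) * burge_series q x y i))) => j lt_j.
have -> : inv_qfac q M j * (q ^+ (j * j) * burge_series q x y j)
  = q ^+ (j * j) * (Q * Q^-1 * inv_qfac q M j) * burge_series q x y j.
  by rewrite /Q divff // mul1r; ring.
apply: cvgC_mul; last by apply: (@burge_poly_lim _ _ _ j) => // n; lia.
apply: cvgC_mul; first exact: cvgC_cst.
apply: cvgC_mul; last exact: cvgC_cst.
apply: cvgC_mul; first by apply: (@qf_lim _ j) => // n; lia.
by apply: cvgC_inv => //; apply: (@qf_lim _ 0) => // n; lia.
Qed.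

Lemma step_qbin_lim f L l : cvgC (fun n => step_qbin q f (L + n) L l) (qf q (2 * L))^-1.
Proof.
have Q0 := qpoch_inf_neq0 (lexx (nm q)).
rewrite [X in cvgC _ X](_ : _ = Q * (qf q (2 * L))^-1 * Q^-1); last by rewrite /Q mulrC mulKf.
rewrite /step_qbin; case: f; (apply: cvgC_mul; first apply: cvgC_mul; first by apply: (@qf_lim _ l) => // n; lia).
- exact: cvgC_cst.
- by apply: (@inv_qfac_lim _ 0) => // n; lia.
- exact: cvgC_cst.
- by apply: (@inv_qfac_lim _ 0) => // n; lia.
Qed.

Lemma chain_sum_lim N s L : cvgC (fun n => chain_sum q N s (L + n) L) (chain_series q N s L).
Proof.
have Q0 := qpoch_inf_neq0 (lexx (nm q)).
case: s => [|f s] /=.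
  rewrite [X in cvgC _ X](_ : _ = Q * (qf q L)^-1 * Q^-1); last by rewrite /Q mulrC mulKf.
  apply: cvgC_mul; first apply: cvgC_mul; first by apply: (@qf_lim _ 0) => // n; lia.
  - exact: cvgC_cst.
  - by apply: (@inv_qfac_lim _ 0) => // n; lia.
rewrite mulr_sumr.
apply: (@cvgC_sum _ _ (fun n l => q ^+ step_exp f L l * step_qbin q f (L + n) L l * chain_sum q N s L l)
  (fun l => (qf q (2 * L))^-1 * (q ^+ step_exp f L l * chain_sum q N s L l))) => l _.
rewrite mulrCA mulrA; apply: cvgC_mul; last exact: cvgC_cst.
by apply: cvgC_mul; [exact: cvgC_cst|exact: step_qbin_lim].
Qed.

(** Both sides are limits of [F_{x,y}(L, n) = F_{y,x}(n, L)] as [n] tends to infinity, which is why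
    the pair appears swapped. *)
Lemma chain_series_burge_series N s x y L : (0 < x)%N -> (0 < y)%N -> (L < N)%N ->
  computes_burge q N s x y -> chain_series q N s L = burge_series q y x L.
Proof.
move=> x0 y0 lt_LN hs; have h n : (n <= n + 0)%N by rewrite addn0.
apply: (cvgC_uniq (@chain_sum_lim N s L)).
under eq_fun => n do rewrite hs ?leq_addr // addKn burge_polyC.
exact: (@burge_poly_lim _ _ _ 0 (fun n => n)).
Qed.

End Unit.

(** * The theta series and the diagonal limit *)

Section SumFI.
Variables (R : realType) (q : R[i]).
Notation nm := (@Normc.normc R).
Hypothesis q1 : `|q| < 1.
Let hq n : 1 - q ^+ n.+1 != 0 := one_subX_neq0 q1 n (lexx _).
Let Q := qpoch_inf q q.
Let r0 := nm_ge0 q.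
Let r1 := nm_lt1 q1.

Lemma qf_bounds : exists2 K : R, 1 <= K & forall p n k, nm p <= nm q ->
  [/\ nm (qf p n) <= K, nm (qf p n)^-1 <= K & nm (inv_qfac p n k) <= K].
Proof.
have [K K1 hK] := qprod_bounds r0 r1; exists K => // p n k hp.
have hinv m : nm (qf p m)^-1 <= K.
  have [_] := hK p p m hp hp; rewrite Normc.normcV => h.
  rewrite -[K]invrK lef_pV2 ?posrE //; first by apply: lt_le_trans h; rewrite invr_gt0; lra.
  by rewrite invr_gt0; lra.
split; [by case: (hK p p n hp hp)|exact: hinv|].
by rewrite /inv_qfac; case: ifP => _; [exact: hinv|rewrite Normc.normc0; lra].
Qed.

Lemma unit_pair_bound j : nm (unit_pair q j) <= 2.
Proof.
case: j => [|j]; first by rewrite /unit_pair Normc.normc1; lra.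
rewrite /unit_pair !Normc.normcM nm_natX normcN Normc.normc1 expr1n mul1r.
have h1 := nm_le1 q1 'C(j.+1, 2); have h2 := nm_le1 q1 j.+1.
have h3 : nm (1 + q ^+ j.+1) <= 2.
  by apply: le_trans (le_normcD _ _) _; rewrite Normc.normc1; lra.
have := nm_ge0 (1 + q ^+ j.+1); have := nm_ge0 (q ^+ 'C(j.+1, 2)); nra.
Qed.

Lemma nm_exp_geom m j : (j <= m)%N -> nm (q ^+ m) <= nm q ^+ j.
Proof. by move=> h; rewrite nm_natX; apply: ler_wiXn2l => //; exact: ltW. Qed.

Lemma unit_pair_geom k j : (0 < k)%N -> nm (unit_pair q j * q ^+ (k * (j * j))) <= 2 * nm q ^+ j.
Proof.
move=> k0; rewrite Normc.normcM ler_pM ?nm_ge0 ?unit_pair_bound //.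
by apply: nm_exp_geom; nia.
Qed.

Lemma qbinom2_bound : exists2 B : R, 0 <= B & forall L M a b, nm (qbinom2 q L M a b) <= B.
Proof.
have [K K1 hK] := qf_bounds; have {}hK n k := hK q n k (lexx _).
exists (K * K * (K * K) * (K * K)) => [|L M a b]; first by rewrite !mulr_ge0 //; lra.
have h1 n : nm (qf q n) <= K by case: (hK n 0%N).
have h2 n : nm (qf q n)^-1 <= K by case: (hK n 0%N).
have h3 n k : nm (inv_qfac q n k) <= K by case: (hK n k).
by rewrite /qbinom2 !Normc.normcM !ler_pM ?mulr_ge0 ?nm_ge0.
Qed.

Lemma burge_poly_bound x y : (0 < x)%N -> (0 < y)%N ->
  exists2 B : R, 0 <= B & forall L M, nm (burge_poly q x y L M) <= B.
Proof.
move=> x0 y0; have [B B0 hB] := qbinom2_bound.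
have h1 : 0 < 1 - nm q by rewrite subr_gt0.
exists (2 * B * (1 - nm q)^-1) => [|L M]; first by rewrite !mulr_ge0 // invr_ge0 ltW.
rewrite /burge_poly /burge_poly_upto; apply: le_trans (nm_sum _) _.
apply: (@le_trans _ _ (\sum_(j < (minn L M).+1) 2 * B * nm q ^+ j)).
  apply: ler_sum => j _; rewrite Normc.normcM mulrAC ler_pM ?nm_ge0 //.
  by apply: unit_pair_geom; rewrite muln_gt0 x0.
by rewrite -mulr_sumr ler_wpM2l ?geom_sum // mulr_ge0.
Qed.

(** At [q = 0] the factor [D] of [jacobi_finite] cannot be cancelled, but both sides are then
    [1]. *)
Lemma jacobi_finite_all k n : (0 < k)%N -> let p := q ^+ (2 * k).+1 in
  \sum_(j < n.+1) unit_pair q j * q ^+ (k * (j * j)) * (qf p (n + n) * (inv_qfac p n j / qf p (n + j)))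
  = qprod (q ^+ k) p n * qprod (q ^+ k.+1) p n.
Proof.
move=> k0 p; have [q0|q0] := eqVneq q 0; last first.
  by apply: jacobi_finite => // m; apply: (one_subX_neq0 q1); exact: nm_expS.
have qp0 z m : qprod 0 z m = 1 :> R[i] by rewrite /qprod big1 // => i _; rewrite mul0r subr0.
rewrite /p q0 !expr0n /= eqn0Ngt k0 /= !qp0 big_ord_recl big1 => [|i _]; last first.
  by rewrite expr0n muln_eq0 eqn0Ngt k0 /= mulr0 mul0r.
by rewrite muln0 inv_qfacn0 !qp0 /= invr1 expr0 addr0 !mulr1.
Qed.

(** The p-binomials in the finite identity are bounded and tend to [1/(p;p)_oo], while the theta
    terms decay geometrically. *)
Lemma theta_cvg k : (0 < k)%N -> let p := q ^+ (2 * k).+1 in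
  cvgC (fun n => \sum_(j < n.+1) unit_pair q j * q ^+ (k * (j * j)))
       (qpoch_inf (q ^+ k) p * qpoch_inf (q ^+ k.+1) p * qpoch_inf p p).
Proof.
move=> k0 p; have hp : nm p <= nm q by exact: nm_expS.
have P0 := qpoch_inf_neq0 q1 hp.
have [K K1 hK] := qf_bounds.
have hk : nm (q ^+ k) <= nm q by case: (k) k0 => // m _; exact: nm_expS.
pose f n j := unit_pair q j * q ^+ (k * (j * j)) * (qf p (n + n) * (inv_qfac p n j / qf p (n + j))).
pose g j := unit_pair q j * q ^+ (k * (j * j)) * (qpoch_inf p p)^-1.
have h1 : cvgC (fun n => \sum_(j < n.+1) f n j - \sum_(j < n.+1) g j) 0.
  apply: (@tannery _ _ r0 r1 f g (2 * (K * (K * K)))) => [n j|j].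
    rewrite Normc.normcM mulrAC ler_pM ?nm_ge0 ?unit_pair_geom // !Normc.normcM.
    have [a1 _ _] := hK p (n + n)%N 0%N hp; have [_ a2 _] := hK p (n + j)%N 0%N hp.
    have [_ _ a3] := hK p n j hp.
    by rewrite !ler_pM ?mulr_ge0 ?nm_ge0.
  apply: cvgC_mul; first exact: cvgC_cst.
  rewrite [X in cvgC _ X](_ : _ = qpoch_inf p p * ((qpoch_inf p p)^-1 * (qpoch_inf p p)^-1)); last by rewrite mulVKf.
  apply: cvgC_mul; first by apply: (@qf_lim _ _ q1 _ 0) => // n; lia.
  apply: cvgC_mul; first by apply: (@inv_qfac_lim _ _ q1 _ 0) => // n; lia.
  by apply: cvgC_inv; first (by []); apply: (@qf_lim _ _ q1 _ 0) => // n; lia.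
have h2 : cvgC (fun n => \sum_(j < n.+1) f n j) (qpoch_inf (q ^+ k) p * qpoch_inf (q ^+ k.+1) p).
  apply: (@cvgC_eventually _ (fun n => qprod (q ^+ k) p n * qprod (q ^+ k.+1) p n) _ _ 0%N).
    by move=> n _; rewrite -jacobi_finite_all.
  by apply: cvgC_mul; apply: (qprod_cvg r0 r1) => //; exact: nm_expS.
have h3 : cvgC (fun n => \sum_(j < n.+1) g j) (qpoch_inf (q ^+ k) p * qpoch_inf (q ^+ k.+1) p).
  exact: cvgC_dist0r h1 h2.
have := cvgC_mul h3 (@cvgC_cst R (qpoch_inf p p)); apply: (@cvgC_eventually _ _ _ _ 0%N) => n _.
by rewrite -mulr_suml mulfVK.
Qed.

(** The diagonal values [F_{x+y,y}(n,n)] are evaluated in two ways, and the two limits are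
    compared. *)
Lemma sum_burge_series x y : (0 < x)%N -> (0 < y)%N ->
  cvgC (fun n => \sum_(r < n) q ^+ (r * r) * burge_series q x y r) (rhs q (x + y) y).
Proof.
move=> x0 y0; apply: cvgC_shift.
have xy0 : (0 < (x + y) * y)%N by rewrite muln_gt0 y0; lia.
have Q0 : Q != 0 := qpoch_inf_neq0 q1 (lexx _).
have [K K1 hK] := qf_bounds; have {}hK n k := hK q n k (lexx _).
have [B B0 hB] := qbinom2_bound; have [B' B'0 hB'] := burge_poly_bound x0 y0.
(* From the defining sum: each product of binomials tends to [1/Q^2], leaving the theta series. *)
have hF1 : cvgC (fun n => burge_poly q (x + y) y n n
    - \sum_(j < n.+1) unit_pair q j * q ^+ ((x + y) * y * (j * j)) * (Q^-1 * Q^-1)) 0.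
  apply: (@cvgC_eventually _ (fun n =>
      \sum_(j < n.+1) unit_pair q j * q ^+ ((x + y) * y * (j * j)) * qbinom2 q n n ((x + y) * j) (y * j)
    - \sum_(j < n.+1) unit_pair q j * q ^+ ((x + y) * y * (j * j)) * (Q^-1 * Q^-1)) _ _ 0%N).
    by move=> n _; rewrite /burge_poly minnn.
  apply: (@tannery _ _ r0 r1
     (fun n j => unit_pair q j * q ^+ ((x + y) * y * (j * j)) * qbinom2 q n n ((x + y) * j) (y * j))
     (fun j => unit_pair q j * q ^+ ((x + y) * y * (j * j)) * (Q^-1 * Q^-1)) (2 * B)) => [n j|j].
    by rewrite Normc.normcM mulrAC ler_pM ?nm_ge0 ?unit_pair_geom.
  apply: cvgC_mul; first exact: cvgC_cst.
  rewrite [X in cvgC _ X](_ : _ = Q * Q * (Q^-1 * Q^-1) * (Q^-1 * Q^-1)); last by field.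
  rewrite /qbinom2; apply: cvgC_mul; first apply: cvgC_mul; first apply: cvgC_mul.
  - by apply: (@qf_lim _ _ q1 _ (y * j)) => // n; lia.
  - by apply: (@qf_lim _ _ q1 _ ((x + y) * j)) => // n; lia.
  - apply: cvgC_mul; first by apply: (@inv_qfac_lim _ _ q1 _ 0) => // n; lia.
    by apply: cvgC_inv; first (by []); apply: (@qf_lim _ _ q1 _ 0) => // n; lia.
  - apply: cvgC_mul; first by apply: (@inv_qfac_lim _ _ q1 _ 0) => // n; lia.
    by apply: cvgC_inv; first (by []); apply: (@qf_lim _ _ q1 _ 0) => // n; lia.
(* From the Burge step: the kernel [[3n-i; 2n]] tends to [1/Q], and [q^(i^2)] supplies the geometric
   majorant. *)
have hF2 : cvgC (fun n => burge_poly q (x + y) y n n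
    - \sum_(i < n.+1) q ^+ (i * i) * (Q * Q^-1 * Q^-1) * burge_series q x y i) 0.
  apply: (@cvgC_eventually _ (fun n => \sum_(i < n.+1) q ^+ (i * i)
       * (qf q (2 * n + n - i) / qf q (2 * n) * inv_qfac q n i) * burge_poly q x y (n - i) i
    - \sum_(i < n.+1) q ^+ (i * i) * (Q * Q^-1 * Q^-1) * burge_series q x y i) _ _ 0%N).
    by move=> n _; rewrite (burge_poly_step hq).
  apply: (@tannery _ _ r0 r1 (fun n i => q ^+ (i * i)
       * (qf q (2 * n + n - i) / qf q (2 * n) * inv_qfac q n i) * burge_poly q x y (n - i) i)
     (fun i => q ^+ (i * i) * (Q * Q^-1 * Q^-1) * burge_series q x y i) (K * K * K * B')) => [n j|j].
    have [a1 _ _] := hK (2 * n + n - j)%N 0%N; have [_ a2 _] := hK (2 * n)%N 0%N.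
    have [_ _ a3] := hK n j.
    rewrite !Normc.normcM -mulrA mulrC.
    by rewrite !ler_pM ?mulr_ge0 ?nm_ge0 //; apply: nm_exp_geom; nia.
  apply: cvgC_mul; last by apply: (@burge_poly_lim _ _ q1 _ _ _ j) => // n; lia.
  apply: cvgC_mul; first exact: cvgC_cst.
  apply: cvgC_mul; last by apply: (@inv_qfac_lim _ _ q1 _ 0) => // n; lia.
  apply: cvgC_mul; first by apply: (@qf_lim _ _ q1 _ j) => // n; lia.
  by apply: cvgC_inv; first (by []); apply: (@qf_lim _ _ q1 _ 0) => // n; lia.
have := theta_cvg xy0; cbv zeta; set p := q ^+ _; set Th := _ * _ * _ => hT.
have hF : cvgC (fun n => burge_poly q (x + y) y n n) (Th * (Q^-1 * Q^-1)).
  apply: (cvgC_dist0 hF1).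
  have := cvgC_mul hT (@cvgC_cst R (Q^-1 * Q^-1)); apply: (@cvgC_eventually _ _ _ _ 0%N) => n _.
  by rewrite mulr_suml.
have hS : cvgC (fun n => \sum_(i < n.+1) q ^+ (i * i) * (Q * Q^-1 * Q^-1) * burge_series q x y i)
    (Th * (Q^-1 * Q^-1)).
  exact: cvgC_dist0r hF2 hF.
have -> : rhs q (x + y) y = Th * (Q^-1 * Q^-1) * Q by rewrite /rhs -/p -/Th -/Q; field.
have := cvgC_mul hS (@cvgC_cst R Q); apply: (@cvgC_eventually _ _ _ _ 0%N) => n _.
rewrite mulr_suml; apply: eq_bigr => i _; field.
exact: Q0.
Qed.

End SumFI.

Lemma bsum_bound (R : realType) N n (G : seq nat -> R[i]) (B : R) :
  (forall s, Normc.normc (G s) <= B) ->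
  Normc.normc (bsum N n G) <= N%:R ^+ n * B.
Proof.
elim: n G => [|n IH] G hG /=; first by rewrite expr0 mul1r.
apply: le_trans (nm_sum _) _.
apply: (@le_trans _ _ (\sum_(i < N) N%:R ^+ n * B)).
  by apply: ler_sum => i _; apply: IH.
by rewrite sumr_const card_ord exprS -mulrA mulr_natl.
Qed.

(** Since [n rho^n] is bounded by the geometric series, splitting [rho^(n^2)] as
    [(rho^n)^d rho^(n(n-d))] leaves at most a constant times [rho^n] for [n > d]. *)
Lemma pow_sq_small (R : realType) (rho C : R) d : 0 <= rho -> rho < 1 -> 0 <= C ->
  forall e, 0 < e -> exists N, forall n, (N <= n)%N -> n%:R ^+ d * (C * rho ^+ (n * n)) < e.
Proof.
move=> r0 r1 C0 e e0; pose K := (1 - rho)^-1.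
have K0 : 0 < K by rewrite invr_gt0 subr_gt0.
have hK n : n%:R * rho ^+ n <= K.
  apply: le_trans (geom_sum r0 r1 n).
  rewrite mulr_natl -[X in _ *+ X]card_ord -sumr_const; apply: ler_sum => i _.
  by apply: (ler_wiXn2l r0 (ltW r1)); apply: ltnW.
have h1 : 0 < e / (K ^+ d * C + 1).
  by rewrite divr_gt0 // ltr_wpDl // mulr_ge0 // exprn_ge0 // ltW.
have [N hN] := geom_small r0 r1 h1; exists (maxn N d.+1) => n.
rewrite geq_max => /andP[/hN {}hN hd].
have hC : 0 <= K ^+ d * C by rewrite mulr_ge0 // exprn_ge0 // ltW.
apply: (@le_lt_trans _ _ ((K ^+ d * C) * rho ^+ n)); last first.
  rewrite ltr_pdivlMr in hN; last by lra.
  by have := exprn_ge0 n r0; nra.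
rewrite mulrCA [X in _ <= X]mulrAC [X in _ <= X]mulrC ler_wpM2l //.
have -> : rho ^+ (n * n) = (rho ^+ n) ^+ d * rho ^+ (n * (n - d)).
  by rewrite -exprM -exprD; congr (_ ^+ _); nia.
rewrite mulrA -exprMn ler_pM ?exprn_ge0 ?mulr_ge0 ?exprn_ge0 //.
  by rewrite lerXn2r ?nnegrE ?mulr_ge0 ?exprn_ge0 // ltW.
by apply: (ler_wiXn2l r0 (ltW r1)); nia.
Qed.

(** For [k = a_0] this is [N_1 + m_(a_0+1)]; the default of [nth] realises the convention
    [m_(a_0+1) = 0] when [b = 1]. *)
Definition head_total k (s : seq nat) := (\sum_(i < k.+1) nth 0 s i)%N.

Lemma head_total_cons k n s : head_total k.+1 (n :: s) = (n + head_total k s)%N.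
Proof. by rewrite /head_total big_ord_recl. Qed.

(** * The nested sums for [a > 2b] *)

Section Nested.
Variables (K : fieldType) (q : K) (base : seq nat -> K).

Fixpoint nested_weight k s : K :=
  if k is k'.+1 then q ^+ (head_total k s * head_total k s) / qf q (head 0%N s) * nested_weight k' (behead s)
  else base s.

Lemma nested_weightE k s : nested_weight k s = q ^+ (\sum_(i < k) head_total (k - i) (drop i s) ^ 2)%N
  / (\prod_(i < k) qf q (nth 0%N s i)) * base (drop k s).
Proof.
elim: k s => [|k IH] s; first by rewrite !big_ord0 drop0 expr0 /= divr1 mul1r.
rewrite [LHS]/= IH !big_ord_recl subn0 drop0 exprD invfM -!mulnn.
have hd (i : 'I_k) : drop i (behead s) = drop (lift ord0 i) s by case: s => [|? ?] //=; rewrite ?drop0.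
have -> : drop k (behead s) = drop k.+1 s by case: s {IH hd} => [|? ?].
have -> : nth 0%N s ord0 = head 0%N s by case: s {IH hd}.
under eq_bigr => i _ do rewrite hd.
under [X in _ = _ * (_ * X^-1) * _]eq_bigr => i _ do rewrite lift0 -nth_behead.
by ring.
Qed.

Variables (N e : nat).

Definition nested_sum k r := bsum N (k + e) (fun s => if head_total k s == r then nested_weight k s else 0).

(** Fixing the total [r = n_1 + i] leaves an inner sum of total [i] with weight [1/(q)_(r-i)]. Up to
    [q^(r^2)] this is the recurrence of [burge_series_step]; [r < N] keeps every admissible [n_1] in
    the box. *)
Lemma nested_sum_step k r : (r < N)%N ->
  nested_sum k.+1 r = q ^+ (r * r) * \sum_(i < r.+1) inv_qfac q r i * nested_sum k i.
Proof.
move=> lt_rN; rewrite /nested_sum addSn [LHS]/=.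
transitivity (\sum_(n < N) if (n <= r)%N then q ^+ (r * r) / qf q n * nested_sum k (r - n)%N else 0).
  apply: eq_bigr => n _; case: leqP => [le_nr|lt_rn].
    rewrite bsum_mull; apply: eq_bsum => s _; rewrite head_total_cons.
    have -> : (val n + head_total k s == r)%N = (head_total k s == r - n)%N.
      by rewrite -[RHS](eqn_add2l n) subnKC.
    by case: eqP => [E|_]; rewrite ?mulr0 //= E subnKC.
  rewrite -[RHS](mul0r (bsum N (k + e) (fun=> 0))) bsum_mull; apply: eq_bsum => s _.
  by rewrite head_total_cons mul0r ifF //; lia.
rewrite -(subnKC lt_rN) big_split_ord /= [X in _ + X]big1 ?addr0 => [|i _]; last first.
  by rewrite ifF //; lia.
rewrite mulr_sumr (reindex_inj rev_ord_inj) /=; apply: eq_bigr => -[i /= lt_i] _.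
rewrite subSS leq_subr subKn // /inv_qfac ifT //.
by rewrite subnKC // -/(nested_sum k i); ring.
Qed.

End Nested.

(** * The continued fraction attached to [(a, b)] *)

Section CfFacts.
Variables (a b p r : nat).
Hypothesis cfE : cf a b = cf_aux (p + r) p r.
Hypothesis rp : (0 < r <= p)%N.

Lemma cf_all : all (leq 1) (cf a b).
Proof. by rewrite cfE cf_aux_gt0. Qed.

Lemma cf_cons : cf a b = (p %/ r)%N :: cf_aux (p + r).-1 r (p %% r).
Proof.
rewrite cfE; case: (p + r)%N (leq_addr r p) => [|f] /=; first by lia.
by rewrite ifF //; apply/negbTE; lia.
Qed.

Lemma cfdE : cfd a b = (size (flags (cf a b))).+1.
Proof. by rewrite flags_size ?cf_all // cf_cons. Qed.

Lemma is_t_last : is_t a b (cfd a b).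
Proof.
apply/mapP; exists (size (cf a b)) => //.
by rewrite mem_iota cf_cons /=; lia.
Qed.

Lemma is_t_flags j : (0 < j < cfd a b)%N -> nth false (flags (cf a b)) j.-1 = is_t a b j.
Proof.
move=> hj; rewrite flags_nth ?cf_all //; first by rewrite cf_cons.
by move: hj; rewrite cfdE ltnS.
Qed.

End CfFacts.

Lemma bsumB (K : zmodType) N n (G H : seq nat -> K) :
  bsum N n G - bsum N n H = bsum N n (fun s => G s - H s).
Proof.
elim: n G H => [|n IH] G H //=; rewrite -sumrB; apply: eq_bigr => i _.
by rewrite IH.
Qed.

(** * The two cases of the theorem *)

Section Cases.
Variables (R : realType) (q : R[i]).
Notation nm := (@Normc.normc R).
Hypothesis q1 : `|q| < 1.
Let hq n : 1 - q ^+ n.+1 != 0 := one_subX_neq0 q1 n (lexx _).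

(** The later variables never exceed [m_1] in a nonzero term, so the box sum equals the [N]-th
    partial sum over [m_1] exactly. *)
Lemma term_le_cvg a b : (1 <= b)%N -> (b < a)%N -> coprime a b -> (a <= 2 * b)%N ->
  cvgC (box_sum (cfd a b) (term_le q a b)) (rhs q a b).
Proof.
move=> b1 ltba co le_a2b.
have cfE : cf a b = cf_aux (b + (a - b)) b (a - b).
  rewrite /cf /cf_frac ifF; last by lia.
  (* When [a = 2b], coprimality forces [b = 1], and the convention [(1, 1)] agrees with
     [(b, a - b)]. *)
  case: ifP => // h; have E : a = (2 * b)%N by lia.
  have b_eq1 : b = 1%N.
    by move: co; rewrite E coprimeMl /coprime gcdnn => /andP[_ /eqP].
  by rewrite E b_eq1.
have rp : (0 < a - b <= b)%N by lia.
have co' : coprime b (a - b) by rewrite /coprime -gcdnDr subnK ?(ltnW ltba) // -/(coprime b a) coprime_sym.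
have td := is_t_last cfE rp.
set s := flags (cf a b).
have hs N : computes_burge q N s b (a - b) by rewrite /s cfE; apply: flags_computes_burge => //; lia.
have -> : rhs q a b = rhs q (a - b + b) b by congr (rhs q _ b); lia.
apply: (@cvgC_eventually _ (fun N => \sum_(l < N) q ^+ (l * l) * burge_series q (a - b) b l) _ _ 0%N);
  last by apply: sum_burge_series => //; lia.
move=> N _; symmetry; rewrite /box_sum ffun_bsum (cfdE cfE rp) -/s /=; apply: eq_bigr => l _.
rewrite -(chain_series_burge_series q1 (N := N) (s := s)) //; try lia.
rewrite chain_series_bsum bsum_mull; apply: eq_bsum => v hv.
rewrite -[RHS]/(q ^+ (nth 0%N [:: 0%N, val l & v] 1 * nth 0%N [:: 0%N, val l & v] 1)
  * series_weight q s (fun i => nth 0%N [:: 0%N, val l & v] (1 + i)%N)).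
rewrite -(@coreE _ _ a b 0) //; first by rewrite (cfdE cfE rp).
by move=> i hi; rewrite -(is_t_flags cfE rp) // (cfdE cfE rp) ltnS.
Qed.

Lemma term_gtE a b s : (cfa0 a b <= cfd a b)%N -> is_t a b (cfd a b) ->
    size s = cfd a b ->
  term_gt q a b (nth 0%N (0%N :: s))
  = q ^+ (\sum_(i < cfa0 a b) head_total (cfa0 a b - i) (drop i s) ^ 2)%N
    / (\prod_(i < cfa0 a b) qf q (nth 0%N s i))
    * (if (cfa0 a b < cfd a b)%N then core q a b (cfa0 a b) (nth 0%N (0%N :: s)) else 1).
Proof.
move=> le_a0d td size_s; rewrite /term_gt; set a0 := cfa0 a b in le_a0d *.
set d := cfd a b in le_a0d td size_s *.
have -> : (if (a0 < d)%N then nth 0%N (0%N :: s) a0.+1 else 0%N) = nth 0%N s a0.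
  by case: ifP => //= h; rewrite nth_default // size_s; lia.
have -> : (\sum_(1 <= i < a0.+1) (\sum_(i <= l < a0.+1) nth 0 (0%N :: s) l + nth 0 s a0) ^ 2
    = \sum_(i < a0) head_total (a0 - i) (drop i s) ^ 2)%N.
  rewrite big_add1 big_mkord /=; apply: eq_bigr => -[i /= lt_i] _; congr (_ ^ 2)%N.
  rewrite /head_total big_ord_recr /= nth_drop subnKC ?(ltnW lt_i) //; congr (_ + _)%N.
  rewrite big_add1 /= -[i in LHS]add0n big_addn big_mkord; apply: eq_bigr => j _.
  by rewrite /= nth_drop addnC.
have -> : \prod_(1 <= i < a0.+1) qfac q (nth 0%N (0%N :: s) i) = \prod_(i < a0) qf q (nth 0%N s i).
  by rewrite big_add1 big_mkord.
case: ltnP => h.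
  rewrite /core -/d quadE // -PoszD -!exprnP exprD invfM /=.
  by ring.
(* Without variables [m_j], the remaining denominator is [(q)_0 = 1] and the sum and product over
   them are empty. *)
have -> : a0 = d by lia.
rewrite nth_default ?size_s // muln0 !big_geq ?ltnS // addr0 -exprnP.
by rewrite (_ : qfac q 0 = 1) ?mulr1 //; rewrite /qfac /qpoch big_ord0.
Qed.

Lemma chain_weight_bound s : exists2 B : R, 0 <= B & forall v, nm (chain_weight q s v) <= B.
Proof.
have [K K1 hK] := qf_bounds q1; have {}hK n k := hK q n k (lexx _).
have h1 n : nm (qf q n) <= K by case: (hK n 0%N).
have h2 n : nm (qf q n)^-1 <= K by case: (hK n 0%N).
have h3 n k : nm (inv_qfac q n k) <= K by case: (hK n k).
have K3 : 0 <= K * K * K by rewrite !mulr_ge0 //; lra.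
elim: s => [|f s [B B0 hB]].
  exists (K * K * K) => // v; rewrite /chain_weight !big_ord0 expr0 !mul1r !Normc.normcM.
  by rewrite !ler_pM ?mulr_ge0 ?nm_ge0.
exists (1 * (K * K * K) * B) => [|v]; first by rewrite mul1r mulr_ge0.
have hb : nm (step_qbin q f (v 0) (v 1) (v 2)) <= K * K * K.
  by rewrite /step_qbin; case: f; rewrite !Normc.normcM !ler_pM ?mulr_ge0 ?nm_ge0.
rewrite chain_weight_cons 2!Normc.normcM ler_pM ?mulr_ge0 ?nm_ge0 //.
by rewrite ler_pM ?nm_ge0 ?nm_le1.
Qed.

Lemma series_weight_bound s : exists2 B : R, 0 <= B & forall v, nm (series_weight q s v) <= B.
Proof.
have [K K1 hK] := qf_bounds q1; have {}hK n k := hK q n k (lexx _).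
have h2 n : nm (qf q n)^-1 <= K by case: (hK n 0%N).
case: s => [|f s]; first by exists K => [|v]; [lra|exact: h2].
have [B B0 hB] := chain_weight_bound s.
exists (K * (1 * B)) => [|v]; first by rewrite !mulr_ge0 //; lra.
rewrite /= 2!Normc.normcM ler_pM ?mulr_ge0 ?nm_ge0 //.
by rewrite ler_pM ?nm_ge0 ?nm_le1.
Qed.

(** Only the outermost power of [q] is kept, all other factors being bounded; this gives the decay
    where [head_total] is at least [N]. *)
Lemma nested_weight_bound base B k : (forall s, nm (base s) <= B) ->
  exists2 C : R, 0 <= C & forall s, nm (nested_weight q base k.+1 s) <= C * nm q ^+ (head_total k.+1 s * head_total k.+1 s).
Proof.
move=> hB; have [K K1 hK] := qf_bounds q1; have {}hK n k' := hK q n k' (lexx _).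
have h2 n : nm (qf q n)^-1 <= K by case: (hK n 0%N).
have [C C0 hC] : exists2 C : R, 0 <= C & forall s, nm (nested_weight q base k s) <= C.
  elim: k => [|k [C C0 hC]]; first by exists B => //; exact: le_trans (nm_ge0 _) (hB [::]).
  exists (1 * K * C) => [|s]; first by rewrite !mulr_ge0 //; lra.
  rewrite [nested_weight _ _ _ _]/= 2!Normc.normcM ler_pM ?mulr_ge0 ?nm_ge0 //.
  by rewrite ler_pM ?nm_ge0 ?nm_le1.
exists (K * C) => [|s]; first by rewrite !mulr_ge0 //; lra.
rewrite [nested_weight _ _ _ _]/= 2!Normc.normcM nm_natX -mulrA mulrC.
by rewrite ler_wpM2r ?exprn_ge0 ?nm_ge0 // ler_pM ?nm_ge0.
Qed.

Lemma nested_sum_burge_series base N e k0 x y : (0 < x)%N -> (0 < y)%N ->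
    (forall m, (m < N)%N -> nested_sum q base N e k0 m = q ^+ (m * m) * burge_series q x y m) ->
  forall k m, (m < N)%N -> nested_sum q base N e (k + k0) m = q ^+ (m * m) * burge_series q (k * y + x) y m.
Proof.
move=> x0 y0 h; elim=> [|k IH] m lt_mN; first by rewrite h.
have -> : (k.+1 * y + x = k * y + x + y)%N by rewrite mulSn; lia.
rewrite addSn nested_sum_step // burge_series_step //; last by lia.
by congr (_ * _); apply: eq_bigr => -[i /= lt_i] _; rewrite IH //; lia.
Qed.

(** The box sum differs from the sum over [r_1 < N], where [r_1 = N_1 + m_(a_0+1)],
    by at most [N^d] terms of size [O(|q|^(N^2))]. *)
Lemma box_cvg f base B k e x y L : (forall s, nm (base s) <= B) ->
    (forall s, size s = (k.+1 + e)%N -> f (nth 0%N (0%N :: s)) = nested_weight q base k.+1 s) ->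
    (forall N m, (m < N)%N -> nested_sum q base N e k.+1 m = q ^+ (m * m) * burge_series q x y m) ->
    cvgC (fun N => \sum_(m < N) q ^+ (m * m) * burge_series q x y m) L ->
  cvgC (box_sum (k.+1 + e) f) L.
Proof.
move=> hB hf hS hL.
refine (@cvgC_dist0 R (box_sum (k.+1 + e) f) (fun N => \sum_(m < N) q ^+ (m * m) * burge_series q x y m) L _ hL).
have [C C0 hC] := nested_weight_bound k hB.
have E N : box_sum (k.+1 + e) f N - \sum_(m < N) q ^+ (m * m) * burge_series q x y m
  = bsum N (k.+1 + e) (fun s => if (head_total k.+1 s < N)%N then 0 else nested_weight q base k.+1 s).
  have -> : \sum_(m < N) q ^+ (m * m) * burge_series q x y m
      = bsum N (k.+1 + e) (fun s => if (head_total k.+1 s < N)%N then nested_weight q base k.+1 s else 0).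
    under eq_bigr => m _ do rewrite -(hS N) // /nested_sum.
    rewrite -(@bsum_sum _ N (k.+1 + e) N (fun m s => if head_total k.+1 s == m then nested_weight q base k.+1 s else 0)).
    apply: eq_bsum => s _; case: ltnP => h.
      rewrite (bigD1 (Ordinal h)) //= eqxx big1 ?addr0 // => i ne_i.
      by rewrite ifF //; apply: contra_neqF ne_i => /eqP E; apply: val_inj.
    by rewrite big1 // => i _; rewrite ifF //; have := ltn_ord i; lia.
  rewrite /box_sum ffun_bsum
    (@eq_bsum _ N _ (fun s => f (nth 0%N (0%N :: s))) (nested_weight q base k.+1) hf).
  rewrite bsumB; apply: eq_bsum => s _.
  by case: ifP => _; rewrite ?subrr ?subr0.
apply: (@cvgC_le0 _ _ (fun N => N%:R ^+ (k.+1 + e) * (C * nm q ^+ (N * N)))).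
  by apply: pow_sq_small => //; [exact: nm_ge0|exact: nm_lt1].
move=> N; rewrite E; apply: bsum_bound => s; case: ltnP => h.
  by rewrite Normc.normc0 mulr_ge0 // exprn_ge0 // nm_ge0.
apply: le_trans (hC s) _; rewrite ler_wpM2l //.
by apply: ler_wiXn2l; [exact: nm_ge0|exact/ltW/nm_lt1|nia].
Qed.

(** A box allows [N_1 + m_(a_0+1) >= N], so its sum is not an exact partial sum over that total;
    [box_cvg] absorbs the difference. *)
Lemma term_gt_cvg a b : (1 <= b)%N -> coprime a b -> (2 * b < a)%N ->
  cvgC (box_sum (cfd a b) (term_gt q a b)) (rhs q a b).
Proof.
move=> b1 co lt_a.
have cfE : cf a b = cf_aux (a - b + b) (a - b) b.
  by rewrite /cf /cf_frac ifT.
have rp : (0 < b <= a - b)%N by lia.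
have td := is_t_last cfE rp.
have a0E : cfa0 a b = ((a - b) %/ b)%N by rewrite /cfa0 (cf_cons cfE rp).
have a0_gt0 : (0 < (a - b) %/ b)%N by rewrite divn_gt0; lia.
have hS : cvgC (fun N => \sum_(m < N) q ^+ (m * m) * burge_series q (a - b) b m) (rhs q a b).
  have -> : rhs q a b = rhs q (a - b + b) b by congr (rhs q _ b); lia.
  by apply: sum_burge_series => //; lia.
have dE := cfdE cfE rp; have lE := cf_cons cfE rp.
case Ek : ((a - b) %/ b)%N a0_gt0 => [|k] // _; rewrite Ek in a0E lE.
(* Remainder zero forces [b = 1]. The innermost variable alone yields the seed [q^(m^2)/(q)_m], so
   [a_0 - 1 = k] nested steps remain. *)
case: (posnP ((a - b) %% b)) => r0.
  have l'0 : cf_aux (a - b + b).-1 b ((a - b) %% b) = [::].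
    by rewrite r0; case: ((a - b + b).-1)%N.
  have b_eq1 : b = 1%N.
    have : (b %| a)%N by rewrite -(subnK (ltnW (_ : b < a)%N)) ?dvdn_addl //; [apply/eqP|lia].
    by move: co; rewrite /coprime => /[swap] /gcdn_idPr -> /eqP.
  have aE : (a - b = k * 1 + 1)%N by move: Ek; rewrite b_eq1 divn1; lia.
  have d_eq : cfd a b = (k.+1 + 0)%N by rewrite dE lE l'0 /= cats0 size_nseq; lia.
  rewrite d_eq; apply: (@box_cvg _ (fun=> 1) 1 k 0 (a - b) b) => //.
  - by move=> s; rewrite Normc.normc1.
  - move=> v size_v; rewrite term_gtE ?a0E ?d_eq ?addn0 //; last 2 first.
    + by rewrite -[k.+1]addn0 -d_eq.
    + by rewrite size_v addn0.
    by rewrite ltnn nested_weightE.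
  - move=> N m lt_mN; rewrite aE b_eq1 -addn1; apply: nested_sum_burge_series lt_mN => // {}m lt_mN.
    rewrite nested_sum_step // burge_series_seed // big_ord_recl /= inv_qfacn0 big1 ?addr0 => [|i _].
      by rewrite /nested_sum /= /head_total big_ord1 mulr1.
    by rewrite /nested_sum /= /head_total big_ord1 mulr0.
set l' := cf_aux _ b _ in lE; set s := flags l'.
have [c [l'' l'E]] : exists c l'', l' = c :: l''.
  have : (0 < (a - b + b).-1)%N by lia.
  rewrite /l'; case: ((a - b + b).-1)%N => // f _.
  by rewrite /= ifF ?gtn_eqF //; eexists; eexists.
have flE : flags (cf a b) = nseq k false ++ true :: s by rewrite lE /s l'E.
have d_eq : cfd a b = (k.+1 + (size s).+1)%N by rewrite dE flE size_cat size_nseq /=; lia.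
(* The weight of the [m] part, with [v] starting at [m_(a_0+1)]; its square is the leading term left
   by completing squares. *)
pose base v := q ^+ (nth 0%N v 0 * nth 0%N v 0) * series_weight q s (nth 0%N v).
have [B B0 hB] := series_weight_bound s.
rewrite d_eq; apply: (@box_cvg _ base B k _ (a - b) b) => //.
- by move=> v; rewrite Normc.normcM -[B]mul1r ler_pM ?nm_ge0 ?nm_le1.
- move=> v size_v; rewrite term_gtE ?a0E ?d_eq //; [|by lia|by rewrite -d_eq].
  rewrite ifT; last by lia.
  rewrite nested_weightE (@coreE _ _ _ _ _ _ s) //; last first.
    move=> i lt_i; rewrite -(is_t_flags cfE rp) ?d_eq ?flE; last by lia.
    rewrite nth_cat size_nseq ifF; last by lia.
    by rewrite (_ : (k.+2 + i).-1 - k = i.+1)%N //; lia.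
  congr (_ * (_ * _)); rewrite ?nth_drop ?addn0 //.
  by congr series_weight; apply/funext => i; rewrite nth_drop.
move=> N m lt_mN.
(* The [a_0 = k + 1] nested steps each add [b] to the first parameter, raising it from the remainder
   to [a - b]. *)
have aE : (a - b = k.+1 * b + (a - b) %% b)%N by rewrite {1}(divn_eq (a - b) b) Ek.
rewrite [X in burge_series _ X]aE -[X in nested_sum _ _ _ _ X _]addn0; apply: nested_sum_burge_series lt_mN => // {}m lt_mN.
rewrite /nested_sum add0n [LHS]/=.
have hs : computes_burge q N s b ((a - b) %% b).
  apply: flags_computes_burge => //; [by rewrite r0 ltnW ?ltn_mod| |].
  - by have := ltn_pmod (a - b) b1; lia.
  - by rewrite coprime_modr /coprime -gcdnDr subnK -/(coprime b a) 1?coprime_sym //; lia.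
rewrite -(chain_series_burge_series q1 (N := N) (s := s)) //.
(* With no variables [n_i] left, the total is [m_(a_0+1)] itself, so only the value [m]
   contributes. *)
rewrite (bigD1 (Ordinal lt_mN)) //= big1 ?addr0 => [|i ne_i]; last first.
  rewrite -[RHS](mul0r (bsum N (size s) (fun=> 0))) bsum_mull; apply: eq_bsum => v _.
  rewrite mul0r ifF // /head_total big_ord1 /=; apply: contra_neqF ne_i => /eqP E; exact: val_inj.
rewrite chain_series_bsum bsum_mull; apply: eq_bsum => v _.
by rewrite /head_total big_ord1 /= eqxx.
Qed.
End Cases.

Theorem theorem3p7 (R : realType) (q : R[i]) (a b : nat) :
  `|q| < 1 -> (1 <= b)%N -> (b < a)%N -> coprime a b ->
  ((a <= 2 * b)%N -> cvgC (box_sum (cfd a b) (term_le q a b)) (rhs q a b)) /\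
  ((2 * b < a)%N -> cvgC (box_sum (cfd a b) (term_gt q a b)) (rhs q a b)).
Proof.
by move=> q1 b1 ltba co; split => h; [exact: term_le_cvg|exact: term_gt_cvg].
Qed.
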